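(* Let $R\in M_n(k)\otimes M_n(k)$ be a regular solution of the Quantum Yang-Baxter Equations, with associated dual quasitriangular Hopf algebra $A$. Let $B$ be a braided group obtained as a quotient of the braided matrices $B(R)$, with braided antipode $\underline S$, and write $\mathbf u^{-1}=\underline S\mathbf u$ (the matrix with entries $\underline Su^i{}_j$). Then the assignment $\mathbf u''={\mathbf u'}^{-1}\mathbf u\,\mathbf u'$, where $\mathbf u$ denotes the generators of the first copy of $B$ and $\mathbf u'$ those of the second (coacting) copy of $B$ in the braided tensor product algebra $B\underline\otimes B$, i.e. $$u^i{}_j\ \longmapsto\ \sum_{a,b}\Psi_{B,B}(\underline Su^i{}_a\otimes u^a{}_b)\,(1\otimes u^b{}_j)\ \in B\underline\otimes B,$$ makes $B$ into a right braided $B$-comodule algebra. In particular $\mathbf u''$ is again a realization of $B$, so that the assignment extends to a covariant ($A$-comodule) algebra homomorphism $B\to B\underline\otimes B$.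
   Context: Algebras are unital over a field or commutative ring $k$; repeated indices are summed over $1,\dots,n$. $R$ has components $R^i{}_j{}^k{}_l$ ($(i,j)$ row and column in the first copy of $M_n$, $(k,l)$ in the second), and $R_{21}$ has components $(R_{21})^i{}_j{}^k{}_l=R^k{}_l{}^i{}_j$. $A(R)$: the bialgebra with generators $t^i{}_j$ and $1$, relations $R^i{}_a{}^k{}_b t^a{}_jt^b{}_l=t^k{}_bt^i{}_aR^a{}_j{}^b{}_l$, and $\Delta t^i{}_j=t^i{}_k\otimes t^k{}_j$, $\epsilon(t^i{}_j)=\delta^i{}_j$. Dual quasitriangular structure on a Hopf algebra $A$: a convolution-invertible linear map $\mathcal R:A\otimes A\to k$ with $\mathcal R(ab\otimes c)=\mathcal R(a\otimes c_{(1)})\mathcal R(b\otimes c_{(2)})$, $\mathcal R(a\otimes bc)=\mathcal R(a_{(1)}\otimes c)\mathcal R(a_{(2)}\otimes b)$, $b_{(1)}a_{(1)}\mathcal R(a_{(2)}\otimes b_{(2)})=\mathcal R(a_{(1)}\otimes b_{(1)})a_{(2)}b_{(2)}$. $R$ is regular if a quotient bialgebra $A$ of $A(R)$ is a Hopf algebra (antipode $S$) admitting a dual quasitriangular structure $\mathcal R$ with $\mathcal R(t^i{}_j\otimes t^k{}_l)=R^i{}_j{}^k{}_l$. Such $A,\mathcal R$ are fixed. Right $A$-comodules form a braided category with tensor product coaction $v\otimes w\mapsto v^{(1)}\otimes w^{(1)}\otimes v^{(2)}w^{(2)}$ and braiding $\Psi_{V,W}(v\otimes w)=w^{(1)}\otimes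 v^{(1)}\,\mathcal R(v^{(2)}\otimes w^{(2)})$, where $v\mapsto v^{(1)}\otimes v^{(2)}\in V\otimes A$ denotes the coaction. For algebras $V,W$ in this category (right $A$-comodule algebras), the braided tensor product $V\underline\otimes W$ is $V\otimes W$ with product $(v\otimes w)(u\otimes z)=v\,\Psi_{W,V}(w\otimes u)\,z$; it is again an $A$-comodule algebra. Braided matrices $B(R)$: generators $u^i{}_j$ and $1$, relations $R_{21}\mathbf u_1R_{12}\mathbf u_2=\mathbf u_2R_{21}\mathbf u_1R_{12}$, i.e. $R^k{}_b{}^i{}_au^a{}_cR^c{}_j{}^b{}_du^d{}_l=u^k{}_bR^b{}_d{}^i{}_au^a{}_cR^c{}_j{}^d{}_l$, with right $A$-coaction $u^i{}_j\mapsto u^m{}_n\otimes(St^i{}_m)t^n{}_j$. It is a bialgebra in the braided category of right $A$-comodules with $\underline\Delta u^i{}_j=u^i{}_k\otimes u^k{}_j$, $\underline\epsilon u^i{}_j=\delta^i{}_j$, extended as algebra homomorphisms $\underline\Delta:B(R)\to B(R)\underline\otimes B(R)$ and $\underline\epsilon:B(R)\to k$ (a known fact, assumed). $B$ denotes a quotient of $B(R)$ as a bialgebra in this braided category (so that all structure maps and the $A$-coaction descend) which has a braided antipode: an $A$-comodule map $\underline S:B\to B$ with $\cdot(\underline S\otimes\mathrm{id})\underline\Delta=1\,\underline\epsilon=\cdot(\mathrm{id}\otimes\underline S)\underline\Delta$. A right braided $B$-comodule algebra is an algebra $V$ in the category of right $A$-comodules with an $A$-comodule map $\beta:V\to V\otimes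 B$ satisfying $(\beta\otimes\mathrm{id})\beta=(\mathrm{id}\otimes\underline\Delta)\beta$, $(\mathrm{id}\otimes\underline\epsilon)\beta=\mathrm{id}$, and such that $\beta:V\to V\underline\otimes B$ is an algebra homomorphism. *)

(* Defs.v *)
From HB Require Import structures.
From mathcomp Require Import all_boot all_algebra.
From mathcomp Require Import boolp.

Set Implicit Arguments.
Unset Strict Implicit.
Unset Printing Implicit Defensive.

Import GRing.Theory.
Local Open Scope ring_scope.
Local Open Scope quotient_scope.

(** * Tensor products of modules over a commutative ring

  An element of [V (x) W] is represented by a finite list of pairs [(v, w)],
  read as the sum of the [v (x) w]; two lists are identified when no bilinear
  map distinguishes them, so that bilinear maps factor through the tensor
  product ([tlift_tens], [tlift_linear], [tens_bilinear], [tensor_ind]). *)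

Section Tensor.
Context {k : comNzRingType} {V W : lmodType k}.

Definition tsum (U : nmodType) (f : V -> W -> U) (s : seq (V * W)) : U :=
  \sum_(p <- s) f p.1 p.2.

Definition teq (s1 s2 : seq (V * W)) : bool :=
  `[< forall (U : lmodType k) (f : V -> W -> U),
        bilinear_for *:%R *:%R f -> tsum f s1 = tsum f s2 >].

Lemma teq_refl : reflexive teq.
Proof. by move=> s; apply/asboolP. Qed.

Lemma teq_sym : symmetric teq.
Proof. by move=> s1 s2; apply/asboolP/asboolP => e U f /e. Qed.

Lemma teq_trans : transitive teq.
Proof.
move=> s2 s1 s3 /asboolP e12 /asboolP e23; apply/asboolP => U f bf.
by rewrite e12 ?e23.
Qed.

Canonical teq_equiv := EquivRel teq teq_refl teq_sym teq_trans.

Definition tensor : Type := {eq_quot teq}.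

HB.instance Definition _ := Choice.on tensor.

Definition tens (v : V) (w : W) : tensor := \pi_{eq_quot teq} [:: (v, w)].

(* The linear map V (x) W -> U induced by a bilinear f (meaningless
   otherwise). *)
Definition tlift (U : nmodType) (f : V -> W -> U) (x : tensor) : U :=
  tsum f (repr (x : {eq_quot teq})).

Lemma tlift_pi (U : lmodType k) (f : V -> W -> U) s :
  bilinear_for *:%R *:%R f -> tlift f (\pi_{eq_quot teq} s) = tsum f s.
Proof.
move=> bf; rewrite /tlift; case: piP => s' /eqmodP /asboolP e.
by rewrite (e U f).
Qed.

Lemma tensor_sep (x y : tensor) :
    (forall (U : lmodType k) (f : V -> W -> U),
       bilinear_for *:%R *:%R f -> tlift f x = tlift f y) -> x = y.
Proof.
move=> e; rewrite -[x](reprK (x : {eq_quot teq})) -[y](reprK (y : {eq_quot teq})).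
by apply/eqmodP/asboolP => U f /e.
Qed.

Let tzero : tensor := \pi_{eq_quot teq} [::].
Let tadd (x y : tensor) : tensor :=
  \pi_{eq_quot teq} (repr (x : {eq_quot teq}) ++ repr (y : {eq_quot teq})).
Let topp (x : tensor) : tensor :=
  \pi_{eq_quot teq} [seq (- p.1, p.2) | p <- repr (x : {eq_quot teq})].
Let tscale (a : k) (x : tensor) : tensor :=
  \pi_{eq_quot teq} [seq (a *: p.1, p.2) | p <- repr (x : {eq_quot teq})].

Section Lift.
Context {U : lmodType k} {f : V -> W -> U}.
Hypothesis bf : bilinear_for *:%R *:%R f.

Let fD v v' w : f (v + v') w = f v w + f v' w.
Proof. by have := bf.1 w 1 v v'; rewrite /= !scale1r. Qed.
Let f0 w : f 0 w = 0.
Proof. by apply: (addrI (f 0 w)); rewrite -fD !addr0. Qed.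
Let fZ a v w : f (a *: v) w = a *: f v w.
Proof. by have := bf.1 w a v 0; rewrite /= f0 !addr0. Qed.

Let tlift_zero : tlift f tzero = 0.
Proof. by rewrite tlift_pi // /tsum big_nil. Qed.
Let tlift_add x y : tlift f (tadd x y) = tlift f x + tlift f y.
Proof. by rewrite tlift_pi // /tsum big_cat. Qed.
Let tlift_opp x : tlift f (topp x) = - tlift f x.
Proof.
rewrite tlift_pi // /tlift /tsum big_map -sumrN; apply: eq_bigr => p _ /=.
by rewrite -scaleN1r fZ scaleN1r.
Qed.
Let tlift_scale a x : tlift f (tscale a x) = a *: tlift f x.
Proof.
rewrite tlift_pi // /tlift /tsum big_map scaler_sumr.
by apply: eq_bigr => p _ /=; rewrite fZ.
Qed.

Definition tliftS := (tlift_zero, tlift_add, tlift_opp, tlift_scale).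

Lemma tlift_tens v w : tlift f (tens v w) = f v w.
Proof. by rewrite tlift_pi // /tsum big_seq1. Qed.

End Lift.

Let taddA : associative tadd.
Proof. by move=> x y z; apply: tensor_sep => U f bf; rewrite !tliftS // addrA. Qed.
Let taddC : commutative tadd.
Proof. by move=> x y; apply: tensor_sep => U f bf; rewrite !tliftS // addrC. Qed.
Let tadd0 : left_id tzero tadd.
Proof. by move=> x; apply: tensor_sep => U f bf; rewrite !tliftS // add0r. Qed.
Let taddN : left_inverse tzero topp tadd.
Proof. by move=> x; apply: tensor_sep => U f bf; rewrite !tliftS // addNr. Qed.

HB.instance Definition _ := GRing.isZmodule.Build tensor taddA taddC tadd0 taddN.

Let tscaleA a b x : tscale a (tscale b x) = tscale (a * b) x.
Proof. by apply: tensor_sep => U f bf; rewrite !tliftS // scalerA. Qed.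
Let tscale1 : left_id 1 tscale.
Proof. by move=> x; apply: tensor_sep => U f bf; rewrite !tliftS // scale1r. Qed.
Let tscaleDr : right_distributive tscale +%R.
Proof. by move=> a x y; apply: tensor_sep => U f bf; rewrite !tliftS // scalerDr. Qed.
Let tscaleDl x : {morph tscale^~ x : a b / a + b}.
Proof. by move=> a b; apply: tensor_sep => U f bf; rewrite !tliftS // scalerDl. Qed.

HB.instance Definition _ :=
  GRing.Zmodule_isLmodule.Build k tensor tscaleA tscale1 tscaleDr tscaleDl.

Lemma tlift_linear (U : lmodType k) (f : V -> W -> U) :
  bilinear_for *:%R *:%R f -> linear (tlift f).
Proof. by move=> bf a x y; rewrite !tliftS. Qed.

Lemma tens_bilinear : bilinear_for *:%R *:%R tens.
Proof.
split=> [w|v] a x y; apply: tensor_sep => U f bf.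
  by rewrite !(tliftS, tlift_tens) //; apply: bf.1.
by rewrite !(tliftS, tlift_tens) //; apply: bf.2.
Qed.

Lemma tensor_ind (P : tensor -> Prop) :
  P 0 -> (forall v w x, P x -> P (tens v w + x)) -> forall x, P x.
Proof.
move=> P0 PS x; rewrite -[x](reprK (x : {eq_quot teq})).
elim: (repr _) => [//|[v w] s /PS - /(_ v w)]; congr P.
by apply: tensor_sep => U f bf; rewrite tliftS // tlift_tens // !tlift_pi // /tsum big_cons.
Qed.

End Tensor.

Arguments tensor {k} V W.

Notation "{ 'tensor' V & W }" := (tensor V W)
  (V at level 69, format "{ 'tensor'  V  &  W }") : type_scope.
Notation "v *t w" := (tens v w) (at level 40, left associativity) : ring_scope.

(* Sweedler notation: [\sw_(x, y <- t) F] is F linearly extended from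
   t = x (x) y, where F is bilinear in x and y. *)
Notation "\sw_ ( x , y <- t ) F" := (tlift (fun x y => F) t)
  (at level 41, F at level 41, x binder, y binder,
   format "'[' \sw_ ( x ,  y  <-  t ) '/  '  F ']'") : ring_scope.


(** * Algebras by generators and relations

  A presentation consists of generators [X] and of the predicate [rel C f]
  saying that the family [f : X -> C] satisfies the relations in the algebra
  [C].  The algebra presented is made of the noncommutative polynomial
  expressions in [X], two of them being identified when they take the same
  value on every such family.  Since [algType] excludes the zero algebra, a
  presentation also contains a character [aug], which makes the presented
  algebra nonzero. *)

Inductive pexpr (k X : Type) :=
  | PGen of X
  | PCst of k
  | PAdd of pexpr k X & pexpr k X
  | PMul of pexpr k X & pexpr k X.

Arguments PGen {k X}.
Arguments PCst {k X}.

HB.instance Definition _ (k X : Type) := gen_eqMixin (pexpr k X).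
HB.instance Definition _ (k X : Type) := gen_choiceMixin (pexpr k X).

Record presentation (k : comNzRingType) := Presentation {
  gens : Type;
  rel : forall C : algType k, (gens -> C) -> Prop;
  aug : gens -> k^o;
  augP : rel aug
}.

Section Presented.
Context {k : comNzRingType}.

Fixpoint peval (X : Type) (C : algType k) (f : X -> C) (e : pexpr k X) : C :=
  match e with
  | PGen x => f x
  | PCst a => a%:A
  | PAdd e1 e2 => peval f e1 + peval f e2
  | PMul e1 e2 => peval f e1 * peval f e2
  end.

Context {P : presentation k}.
Local Notation X := (gens P).

Definition peq (e1 e2 : pexpr k X) : bool :=
  `[< forall (C : algType k) (f : X -> C),
        rel f -> peval f e1 = peval f e2 >].

Lemma peq_refl : reflexive peq.
Proof. by move=> e; apply/asboolP. Qed.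

Lemma peq_sym : symmetric peq.
Proof. by move=> e1 e2; apply/asboolP/asboolP => e C f /e. Qed.

Lemma peq_trans : transitive peq.
Proof.
move=> e2 e1 e3 /asboolP e12 /asboolP e23; apply/asboolP => C f rf.
by rewrite e12 ?e23.
Qed.

Canonical peq_equiv := EquivRel peq peq_refl peq_sym peq_trans.

Definition presented : Type := {eq_quot peq}.

HB.instance Definition _ := Choice.on presented.

Let cls (e : pexpr k X) : presented := \pi_{eq_quot peq} e.
Let rep (x : presented) : pexpr k X := repr (x : {eq_quot peq}).

Definition pgen (x : X) : presented := cls (PGen x).

(* The algebra map induced by a family f satisfying the relations
   (meaningless otherwise). *)
Definition plift (C : algType k) (f : X -> C) (x : presented) : C :=
  peval f (rep x).

Lemma plift_cls (C : algType k) (f : X -> C) e :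
  rel f -> plift f (cls e) = peval f e.
Proof.
move=> rf; rewrite /plift /rep /cls; case: piP => e' /eqmodP /asboolP eq_e.
by rewrite (eq_e C f).
Qed.

Lemma presented_sep (x y : presented) :
  (forall (C : algType k) (f : X -> C), rel f -> plift f x = plift f y) ->
  x = y.
Proof.
move=> eq_xy; rewrite -[x](reprK (x : {eq_quot peq})).
rewrite -[y](reprK (y : {eq_quot peq})).
by apply/eqmodP/asboolP => C f /eq_xy.
Qed.

Let pzero := cls (PCst 0).
Let pone := cls (PCst 1).
Let padd x y := cls (PAdd (rep x) (rep y)).
Let pmul x y := cls (PMul (rep x) (rep y)).
Let pscale a x := cls (PMul (PCst a) (rep x)).
Let popp x := pscale (-1) x.

Section Lift.
Context {C : algType k} {f : X -> C}.
Hypothesis rf : rel f.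

Let plift_zero : plift f pzero = 0.
Proof. by rewrite plift_cls //= scale0r. Qed.
Let plift_one : plift f pone = 1.
Proof. by rewrite plift_cls //= scale1r. Qed.
Let plift_add x y : plift f (padd x y) = plift f x + plift f y.
Proof. by rewrite plift_cls. Qed.
Let plift_mul x y : plift f (pmul x y) = plift f x * plift f y.
Proof. by rewrite plift_cls. Qed.
Let plift_scale a x : plift f (pscale a x) = a *: plift f x.
Proof. by rewrite plift_cls //= -scalerAl mul1r. Qed.
Let plift_opp x : plift f (popp x) = - plift f x.
Proof. by rewrite plift_scale scaleN1r. Qed.

Definition pliftS :=
  (plift_zero, plift_one, plift_add, plift_mul, plift_opp, plift_scale).

Lemma plift_gen x : plift f (pgen x) = f x.
Proof. by rewrite plift_cls. Qed.

End Lift.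

Let paddA : associative padd.
Proof. by move=> x y z; apply: presented_sep => C f rf; rewrite !pliftS // addrA. Qed.
Let paddC : commutative padd.
Proof. by move=> x y; apply: presented_sep => C f rf; rewrite !pliftS // addrC. Qed.
Let padd0 : left_id pzero padd.
Proof. by move=> x; apply: presented_sep => C f rf; rewrite !pliftS // add0r. Qed.
Let paddN : left_inverse pzero popp padd.
Proof. by move=> x; apply: presented_sep => C f rf; rewrite !pliftS // addNr. Qed.

HB.instance Definition _ :=
  GRing.isZmodule.Build presented paddA paddC padd0 paddN.

Let pmulA : associative pmul.
Proof. by move=> x y z; apply: presented_sep => C f rf; rewrite !pliftS // mulrA. Qed.
Let pmul1l : left_id pone pmul.
Proof. by move=> x; apply: presented_sep => C f rf; rewrite !pliftS // mul1r. Qed.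
Let pmul1r : right_id pone pmul.
Proof. by move=> x; apply: presented_sep => C f rf; rewrite !pliftS // mulr1. Qed.
Let pmulDl : left_distributive pmul +%R.
Proof. by move=> x y z; apply: presented_sep => C f rf; rewrite !pliftS // mulrDl. Qed.
Let pmulDr : right_distributive pmul +%R.
Proof. by move=> x y z; apply: presented_sep => C f rf; rewrite !pliftS // mulrDr. Qed.
Let pone_neq0 : pone != 0.
Proof.
apply/eqP => /(congr1 (plift (@aug k P))).
by rewrite !pliftS; [move/eqP; rewrite oner_eq0 | exact: augP..].
Qed.

HB.instance Definition _ := GRing.Zmodule_isNzRing.Build presented
  pmulA pmul1l pmul1r pmulDl pmulDr pone_neq0.

Let pscaleA a b x : pscale a (pscale b x) = pscale (a * b) x.
Proof. by apply: presented_sep => C f rf; rewrite !pliftS // scalerA. Qed.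
Let pscale1 : left_id 1 pscale.
Proof. by move=> x; apply: presented_sep => C f rf; rewrite !pliftS // scale1r. Qed.
Let pscaleDr : right_distributive pscale +%R.
Proof. by move=> a x y; apply: presented_sep => C f rf; rewrite !pliftS // scalerDr. Qed.
Let pscaleDl x : {morph pscale^~ x : a b / a + b}.
Proof. by move=> a b; apply: presented_sep => C f rf; rewrite !pliftS // scalerDl. Qed.

HB.instance Definition _ := GRing.Zmodule_isLmodule.Build k presented
  pscaleA pscale1 pscaleDr pscaleDl.

Let pscaleAl a (x y : presented) : a *: (x * y) = (a *: x) * y.
Proof. by apply: presented_sep => C f rf; rewrite !pliftS // scalerAl. Qed.

HB.instance Definition _ := GRing.Lmodule_isLalgebra.Build k presented pscaleAl.

Let pscaleAr a (x y : presented) : a *: (x * y) = x * (a *: y).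
Proof. by apply: presented_sep => C f rf; rewrite !pliftS // scalerAr. Qed.

HB.instance Definition _ := GRing.Lalgebra_isAlgebra.Build k presented pscaleAr.

Section LiftMorphism.
Context {C : algType k} {f : X -> C}.
Hypothesis rf : rel f.

Lemma plift_linear : linear (plift f : presented -> C).
Proof. by move=> a x y; rewrite !pliftS. Qed.

Lemma plift_monoid : monoid_morphism (plift f : presented -> C).
Proof. by split=> [|x y]; rewrite !pliftS. Qed.

Lemma plift_sum (I : Type) (s : seq I) (Q : pred I) (F : I -> presented) :
  plift f (\sum_(i <- s | Q i) F i) = \sum_(i <- s | Q i) plift f (F i).
Proof. by apply: big_morph => [x y|]; rewrite pliftS. Qed.

End LiftMorphism.

Lemma presented_ind (Q : presented -> Prop) :
    (forall x, Q (pgen x)) -> (forall a, Q a%:A) ->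
    (forall x y, Q x -> Q y -> Q (x + y)) ->
    (forall x y, Q x -> Q y -> Q (x * y)) ->
  forall x, Q x.
Proof.
move=> Qg Qc QD QM x; rewrite -[x](reprK (x : {eq_quot peq})).
elim: (repr _) => [y|a|e1 IH1 e2 IH2|e1 IH1 e2 IH2].
- exact: Qg.
- by congr Q: (Qc a); apply: presented_sep => C f rf; rewrite !pliftS ?plift_cls.
- congr Q: (QD _ _ IH1 IH2).
  by apply: presented_sep => C f rf; rewrite !pliftS // !plift_cls.
- congr Q: (QM _ _ IH1 IH2).
  by apply: presented_sep => C f rf; rewrite !pliftS // !plift_cls.
Qed.

End Presented.

Arguments presented {k} P.

(** * Hopf algebras and dual quasitriangular structures *)

Section Hopf.
Context {k : comNzRingType}.

Record bialg (H : algType k) := Bialg {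
  comul : {linear H -> {tensor H & H}};
  counit : {lrmorphism H -> k | *%R};
  comulA : forall h,
    \sw_(x, y <- comul h) \sw_(y1, y2 <- comul y) x *t y1 *t y2 =
    \sw_(x, y <- comul h) \sw_(x1, x2 <- comul x) x1 *t x2 *t y;
  counitl : forall h, \sw_(x, y <- comul h) counit x *: y = h;
  counitr : forall h, \sw_(x, y <- comul h) counit y *: x = h;
  comul1 : comul 1 = 1 *t 1;
  comulM : forall g h, comul (g * h) =
    \sw_(x1, x2 <- comul g) \sw_(y1, y2 <- comul h) (x1 * y1) *t (x2 * y2)
}.

Record hopf (H : algType k) := Hopf {
  hopf_bialg :> bialg H;
  antipode : {linear H -> H};
  antipodel : forall h, \sw_(x, y <- comul hopf_bialg h) antipode x * y =
                        counit hopf_bialg h *: 1;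
  antipoder : forall h, \sw_(x, y <- comul hopf_bialg h) x * antipode y =
                        counit hopf_bialg h *: 1
}.

Definition surjective (T U : Type) (f : T -> U) := forall y, exists x, f x = y.

Record bialg_quotient (H H' : algType k) (h : bialg H) (h' : bialg H')
    (p : {lrmorphism H -> H'}) : Prop := BialgQuotient {
  bq_surj : surjective p;
  bq_comul : forall x, comul h' (p x) = \sw_(y, z <- comul h x) p y *t p z;
  bq_counit : forall x, counit h' (p x) = counit h x
}.

Definition convolution (H : algType k) (h : bialg H)
    (f g : {scalar {tensor H & H}}) (a b : H) : k :=
  \sw_(a1, a2 <- comul h a) \sw_(b1, b2 <- comul h b)
    f (a1 *t b1) * g (a2 *t b2).

Record dqt (H : algType k) (h : bialg H) := Dqt {
  dqt_form :> {scalar {tensor H & H}};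
  dqt_inv : exists g : {scalar {tensor H & H}}, forall a b,
    convolution h dqt_form g a b = counit h a * counit h b /\
    convolution h g dqt_form a b = counit h a * counit h b;
  dqtMl : forall a b c, dqt_form ((a * b) *t c) =
    \sw_(c1, c2 <- comul h c) dqt_form (a *t c1) * dqt_form (b *t c2);
  dqtMr : forall a b c, dqt_form (a *t (b * c)) =
    \sw_(a1, a2 <- comul h a) dqt_form (a1 *t c) * dqt_form (a2 *t b);
  dqtC : forall a b,
    \sw_(a1, a2 <- comul h a) \sw_(b1, b2 <- comul h b)
      dqt_form (a2 *t b2) *: (b1 * a1) =
    \sw_(a1, a2 <- comul h a) \sw_(b1, b2 <- comul h b)
      dqt_form (a1 *t b1) *: (a2 * b2)
}.

End Hopf.

(** * The braided category of right comodules *)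

Section Comodules.
Context {k : comNzRingType} {H : algType k} {h : bialg H}.

Definition comodule_map (V W : lmodType k) (rV : V -> {tensor V & H})
    (rW : W -> {tensor W & H}) (f : V -> W) : Prop :=
  forall v, rW (f v) = \sw_(v1, a <- rV v) f v1 *t a.

Definition coact_tensor (V W : lmodType k) (rV : V -> {tensor V & H})
    (rW : W -> {tensor W & H}) (x : {tensor V & W}) :
    {tensor {tensor V & W} & H} :=
  \sw_(v, w <- x) \sw_(v1, a <- rV v) \sw_(w1, b <- rW w)
    (v1 *t w1) *t (a * b).

Definition braiding (r : dqt h) (V W : lmodType k) (rV : V -> {tensor V & H})
    (rW : W -> {tensor W & H}) (x : {tensor V & W}) : {tensor W & V} :=
  \sw_(v, w <- x) \sw_(v1, a <- rV v) \sw_(w1, b <- rW w)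
    r (a *t b) *: (w1 *t v1).

Record comodalg (h : bialg H) (V : algType k) := Comodalg {
  coact :> {linear V -> {tensor V & H}};
  coactA : forall v,
    \sw_(v1, a <- coact v) \sw_(v2, b <- coact v1) v2 *t b *t a =
    \sw_(v1, a <- coact v) \sw_(a1, a2 <- comul h a) v1 *t a1 *t a2;
  coact_counit : forall v, \sw_(v1, a <- coact v) counit h a *: v1 = v;
  coact1 : coact 1 = 1 *t 1;
  coactM : forall v w, coact (v * w) =
    \sw_(v1, a <- coact v) \sw_(w1, b <- coact w) (v1 * w1) *t (a * b)
}.

(* The product (v (x) w)(u (x) z) = v Psi(w (x) u) z of the braided tensor
   product algebra of V and W; its unit is 1 (x) 1. *)
Definition bmul (r : dqt h) (V W : algType k) (cV : comodalg h V)
    (cW : comodalg h W) (x y : {tensor V & W}) : {tensor V & W} :=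
  \sw_(v, w <- x) \sw_(u, z <- y) \sw_(u1, w1 <- braiding r cW cV (w *t u))
    (v * u1) *t (w1 * z).

End Comodules.

Section Braided.
Context {k : comNzRingType} {H : algType k} {h : bialg H}.

Record bbialg (r : dqt h) (B : algType k) := Bbialg {
  bcoact :> comodalg h B;
  bcomul : {linear B -> {tensor B & B}};
  bcounit : {lrmorphism B -> k | *%R};
  bcomul_comod : comodule_map bcoact (coact_tensor bcoact bcoact) bcomul;
  (* k has the trivial coaction, and k (x) H is identified with H *)
  bcounit_comod : forall b,
    \sw_(b1, a <- bcoact b) bcounit b1 *: a = bcounit b *: 1;
  bcomulA : forall b,
    \sw_(x, y <- bcomul b) \sw_(y1, y2 <- bcomul y) x *t y1 *t y2 =
    \sw_(x, y <- bcomul b) \sw_(x1, x2 <- bcomul x) x1 *t x2 *t y;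
  bcounitl : forall b, \sw_(x, y <- bcomul b) bcounit x *: y = b;
  bcounitr : forall b, \sw_(x, y <- bcomul b) bcounit y *: x = b;
  bcomul1 : bcomul 1 = 1 *t 1;
  bcomulM : forall b c,
    bcomul (b * c) = bmul r bcoact bcoact (bcomul b) (bcomul c)
}.

Record bhopf (r : dqt h) (B : algType k) := Bhopf {
  bhopf_bbialg :> bbialg r B;
  bantipode : {linear B -> B};
  bantipode_comod : comodule_map bhopf_bbialg bhopf_bbialg bantipode;
  bantipodel : forall b, \sw_(x, y <- bcomul bhopf_bbialg b) bantipode x * y =
                         bcounit bhopf_bbialg b *: 1;
  bantipoder : forall b, \sw_(x, y <- bcomul bhopf_bbialg b) x * bantipode y =
                         bcounit bhopf_bbialg b *: 1
}.

Record bbialg_quotient (r : dqt h) (B B' : algType k) (b : bbialg r B)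
    (b' : bbialg r B') (q : {lrmorphism B -> B'}) : Prop := BbialgQuotient {
  bbq_surj : surjective q;
  bbq_coact : comodule_map b b' q;
  bbq_comul : forall x, bcomul b' (q x) = \sw_(y, z <- bcomul b x) q y *t q z;
  bbq_counit : forall x, bcounit b' (q x) = bcounit b x
}.

Record braided_comodalg (r : dqt h) (B : algType k) (b : bbialg r B)
    (V : algType k) (cV : comodalg h V) (beta : {linear V -> {tensor V & B}}) :
    Prop := BraidedComodalg {
  bc_comod : comodule_map cV (coact_tensor cV b) beta;
  bc_coact : forall v,
    \sw_(v1, x <- beta v) \sw_(v2, y <- beta v1) v2 *t y *t x =
    \sw_(v1, x <- beta v) \sw_(x1, x2 <- bcomul b x) v1 *t x1 *t x2;
  bc_counit : forall v, \sw_(v1, x <- beta v) bcounit b x *: v1 = v;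
  bc1 : beta 1 = 1 *t 1;
  bcM : forall v w, beta (v * w) = bmul r cV b (beta v) (beta w)
}.

End Braided.

(** * R-matrices, A(R) and B(R) *)

Section RMatrix.
Context {k : comNzRingType} {n : nat}.
Implicit Types (R : {tensor 'M[k]_n & 'M[k]_n}) (C : algType k).

(* R^i_j^p_q, with (i, j) row and column in the first copy of M_n and (p, q)
   in the second. *)
Definition entry R (i j p q : 'I_n) : k :=
  tlift (fun x y : 'M[k]_n => x i j * y p q) R.

(* R12 R13 R23 = R23 R13 R12, in components *)
Definition QYBE R : Prop := forall i j p q s t : 'I_n,
  \sum_a \sum_b \sum_c entry R i a p b * entry R a j s c * entry R b q c t =
  \sum_a \sum_b \sum_c entry R p b s c * entry R i a c t * entry R a j b q.

Definition FRT_rel R C (t : 'I_n -> 'I_n -> C) : Prop :=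
  forall i j p q,
    \sum_a \sum_b entry R i a p b *: (t a j * t b q) =
    \sum_a \sum_b entry R a j b q *: (t p b * t i a).

(* R21 u1 R12 u2 = u2 R21 u1 R12, in components *)
Definition BM_rel R C (u : 'I_n -> 'I_n -> C) : Prop :=
  forall i j p q,
    \sum_a \sum_b \sum_c \sum_d
      (entry R p b i a * entry R c j b d) *: (u a c * u d q) =
    \sum_a \sum_b \sum_c \sum_d
      (entry R b d i a * entry R c j d q) *: (u p b * u a c).

Definition delta (ij : 'I_n * 'I_n) : k^o := (ij.1 == ij.2)%:R.

Lemma sum_delta (F : 'I_n -> 'I_n -> k) (i j : 'I_n) :
  \sum_a \sum_b F a b * ((a == i)%:R * (b == j)%:R) = F i j.
Proof.
rewrite (bigD1 i) //= (bigD1 j) //= !eqxx !mulr1 big1 ?addr0 => [|b /negPf ->].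
  rewrite big1 ?addr0 // => a /negPf ->.
  by rewrite big1 // => b _; rewrite mul0r mulr0.
by rewrite !mulr0.
Qed.

Lemma FRT_aug R : FRT_rel R (fun i j => delta (i, j)).
Proof.
move=> i j p q; transitivity (entry R i j p q); last symmetry.
  exact: (sum_delta (fun a b => entry R i a p b)).
rewrite -(sum_delta (fun a b => entry R a j b q)).
apply: eq_bigr => a _; apply: eq_bigr => b _.
by rewrite /delta /= (eq_sym i) (eq_sym p); congr (_ * _); exact: mulrC.
Qed.

Lemma BM_aug R : BM_rel R (fun i j => delta (i, j)).
Proof.
move=> i j p q.
transitivity (\sum_a \sum_b entry R p b i a * entry R a j b q).
  apply: eq_bigr => a _; apply: eq_bigr => b _.
  rewrite -(sum_delta (fun c d => entry R p b i a * entry R c j b d)).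
  apply: eq_bigr => c _; apply: eq_bigr => d _.
  by rewrite /delta /= (eq_sym a).
apply: eq_bigr => a _; symmetry.
under eq_bigr => b _ do rewrite exchange_big.
rewrite exchange_big; apply: eq_bigr => d _ /=.
rewrite -(sum_delta (fun b c => entry R b d i a * entry R c j d q)).
apply: eq_bigr => b _; apply: eq_bigr => c _.
by rewrite /delta /= (eq_sym p) (eq_sym a).
Qed.

Definition FRT_presentation R : presentation k :=
  @Presentation k ('I_n * 'I_n) (fun C f => FRT_rel R (fun i j => f (i, j)))
    delta (FRT_aug R).

Definition BM_presentation R : presentation k :=
  @Presentation k ('I_n * 'I_n) (fun C f => BM_rel R (fun i j => f (i, j)))
    delta (BM_aug R).

(* The algebras A(R) and B(R), with their matrices of generators. *)
Definition FRT R := presented (FRT_presentation R).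
Definition BM R := presented (BM_presentation R).

HB.instance Definition _ R := GRing.Algebra.on (FRT R).
HB.instance Definition _ R := GRing.Algebra.on (BM R).

Definition tgen R (i j : 'I_n) : FRT R := @pgen k (FRT_presentation R) (i, j).
Definition ugen R (i j : 'I_n) : BM R := @pgen k (BM_presentation R) (i, j).

Lemma tgen_rel R : FRT_rel R (tgen R).
Proof.
move=> i j p q; apply: presented_sep => C f rf.
rewrite !plift_sum //; have := rf i j p q; congr (_ = _);
  apply: eq_bigr => a _; rewrite plift_sum //; apply: eq_bigr => b _;
  by rewrite !(pliftS rf, plift_gen rf).
Qed.

Lemma ugen_rel R : BM_rel R (ugen R).
Proof.
move=> i j p q; apply: presented_sep => C f rf.
rewrite !plift_sum //; have := rf i j p q; congr (_ = _);
  apply: eq_bigr => a _; rewrite plift_sum //; apply: eq_bigr => b _;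
  rewrite plift_sum //; apply: eq_bigr => c _;
  rewrite plift_sum //; apply: eq_bigr => d _;
  by rewrite !(pliftS rf, plift_gen rf).
Qed.

(* The bialgebra structure of A(R) and the braided bialgebra structure of B(R):
   the values on generators determine each of them uniquely. *)
Record FRT_bialg R := FRTBialg {
  frt :> bialg (FRT R);
  frt_comul : forall i j,
    comul frt (tgen R i j) = \sum_a tgen R i a *t tgen R a j;
  frt_counit : forall i j, counit frt (tgen R i j) = (i == j)%:R
}.

Record BM_bbialg R (A : algType k) (hA : hopf A) (t : 'I_n -> 'I_n -> A)
    (r : dqt hA) := BMBbialg {
  bm :> bbialg r (BM R);
  bm_coact : forall i j, bcoact bm (ugen R i j) =
    \sum_a \sum_b ugen R a b *t (antipode hA (t i a) * t b j);
  bm_comul : forall i j,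
    bcomul bm (ugen R i j) = \sum_a ugen R i a *t ugen R a j;
  bm_counit : forall i j, bcounit bm (ugen R i j) = (i == j)%:R
}.

End RMatrix.

(* Main.v *)
(* Let psi : B -> B (x) B be the braided coproduct, an algebra map into the braided
   tensor product, and phi the inclusion of the second copy of B.  As psi(u) = u u',
   the assignment u'' = u'^-1 u u' is b |-> phi(S b_1) psi(b_2), the braided
   adjoint coaction; it is defined on every quotient B of B(R), and it is covariant
   and counital for general reasons.

   The point is multiplicativity.  For w in B, let P(w) and L(w) be the matrices
   with entries w_1 r(w_2 (x) t^i_j) and w_1 r(S t^i_j (x) w_2).  Both P and L are
   algebra maps from B to matrices over B, and for w = u^k_l the relations of B(R)
   say that u L(w) = P(w) u; hence this holds for all w.  It follows that u''
   commutes with phi(L(w)).  The coproducts of E(w) = u L(w) and of L(w) being of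
   matrix type, one gets
     beta(E(w)) = phi(S E(w_1)) psi(u) psi(L(w_2))
                = phi(S E(w_1)) phi(E(w_2)) u'' beta(L(w_3)) = u'' beta(L(w)),
   so beta(u w) = beta(u) beta(w) because L(w) can be inverted in w.

   Once beta is multiplicative, the coaction axiom can be checked on generators,
   where both sides are the conjugate of u by the product u' u'' of the other two
   copies. *)

From HB Require Import structures.
From mathcomp Require Import all_boot all_algebra.
From mathcomp Require Import boolp.
Require Import Defs.

Set Implicit Arguments.
Unset Strict Implicit.
Unset Printing Implicit Defensive.

Import GRing.Theory.
Local Open Scope ring_scope.

(** * Multilinear Sweedler calculus *)

Section LinearForms.
Context {k : comNzRingType}.
Implicit Types (X V W U : lmodType k).

Lemma linear_id X : linear (fun x : X => x).
Proof. by []. Qed.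

Lemma linear_comp X V U (g : V -> U) (f : X -> V) :
  linear g -> linear f -> linear (fun x => g (f x)).
Proof. by move=> lg lf a x y; rewrite lf lg. Qed.

Lemma linear_form X V (g : {scalar V}) (f : X -> V) :
  linear f -> linear (fun x => g (f x) : k^o).
Proof. by move=> lf a x y; rewrite lf; apply: (linearP g). Qed.

Lemma linear_mull X (C : algType k) (f : X -> C) c :
  linear f -> linear (fun x => f x * c).
Proof. by move=> lf a x y; rewrite lf mulrDl scalerAl. Qed.

Lemma linear_mulr X (C : algType k) (f : X -> C) c :
  linear f -> linear (fun x => c * f x).
Proof. by move=> lf a x y; rewrite lf mulrDr scalerAr. Qed.

Lemma linear_scalel X V (f : X -> k^o) (v : V) :
  linear f -> linear (fun x => f x *: v).
Proof. by move=> lf a x y; rewrite lf scalerDl scalerA. Qed.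

Lemma linear_scaler X V (f : X -> V) (c : k) :
  linear f -> linear (fun x => c *: f x).
Proof. by move=> lf a x y; rewrite lf scalerDr !scalerA mulrC. Qed.

Lemma linear_kmull X (f : X -> k^o) (c : k) :
  linear f -> linear (fun x => f x * c : k^o).
Proof. by move=> lf a x y; rewrite lf mulrDl -scalerAl. Qed.

Lemma linear_kmulr X (f : X -> k^o) (c : k) :
  linear f -> linear (fun x => c * f x : k^o).
Proof. by move=> lf a x y; rewrite lf mulrDr; congr (_ + _); apply: mulrCA. Qed.

Lemma linear_sum X V (I : Type) (s : seq I) (Q : pred I) (f : I -> X -> V) :
  (forall i, linear (f i)) -> linear (fun x => \sum_(i <- s | Q i) f i x).
Proof.
move=> lf a x y; rewrite scaler_sumr -big_split /=.
by apply: eq_bigr => i _; apply: lf.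
Qed.

Lemma linear_tensl X V W (f : X -> V) (w : W) :
  linear f -> linear (fun x => f x *t w).
Proof. by move=> lf a x y; rewrite lf; apply: tens_bilinear.1. Qed.

Lemma linear_tensr X V W (f : X -> W) (v : V) :
  linear f -> linear (fun x => v *t f x).
Proof. by move=> lf a x y; rewrite lf; apply: tens_bilinear.2. Qed.

Lemma linear_tlift_arg X V W U (g : V -> W -> U) (f : X -> {tensor V & W}) :
  bilinear_for *:%R *:%R g -> linear f -> linear (fun x => tlift g (f x)).
Proof. by move=> bg lf a x y; rewrite lf; apply: tlift_linear. Qed.

(** [tlift] is a finite sum over the chosen representative of t, so linearity in a parameter is that
    of each summand. *)
Lemma linear_tlift_par X V W U (g : X -> V -> W -> U) (t : {tensor V & W}) :
  (forall v w, linear (fun x => g x v w)) -> linear (fun x => tlift (g x) t).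
Proof. by move=> lg; apply: linear_sum => p; apply: lg. Qed.

End LinearForms.

Definition trilinear (k : comNzRingType) (V W X U : lmodType k)
    (F : V -> W -> X -> U) : Prop :=
  [/\ forall w x, linear (fun v => F v w x),
      forall v x, linear (fun w => F v w x) &
      forall v w, linear (fun x => F v w x)].

(* [lin] proves that a Sweedler expression is linear, or multilinear, in given
   variables.  A term [\sw_(v, w <- t) F] is linear in the parameters of F without
   any assumption, but linear in t only when F is bilinear in v and w. *)
Ltac is_cst f := lazymatch f with (fun _ => ?c) => idtac end.

Ltac not_id f := lazymatch f with (fun x => x) => fail | _ => idtac end.

(** A hook of [lin], redefined with [::=] once operations such as [rho] and [bmul] are available. *)
Ltac lin_ext := fail.

Ltac lin :=
  lazymatch goal with
  | |- bilinear_for _ _ _ =>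
      first [assumption | split; intros ?; lin]
  | |- trilinear _ => split; lin
  | |- forall _, _ => intros ?; lin
  | |- @GRing.linear_for ?R ?U ?V ?s ?f =>
    change (@GRing.linear_for R U V s (fun x => f x));
    cbv beta;
    lazymatch goal with
    | |- GRing.linear_for _ (fun x => x) => exact: linear_id
    | |- GRing.linear_for _ (fun x => tlift (@?g x) (@?t x)) =>
        tryif is_cst t then apply: linear_tlift_par; intros ? ?
        else apply: linear_tlift_arg; lin
    | |- GRing.linear_for _ (fun x => @?v x *t @?w x) =>
        tryif is_cst w then apply: linear_tensl else apply: linear_tensr; lin
    | |- GRing.linear_for _ (fun x => @?v x *: @?w x) =>
        tryif is_cst w then apply: linear_scalel else apply: linear_scaler; lin
    | |- GRing.linear_for _ (fun x => @?v x * @?w x) =>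
        tryif is_cst w then first [apply: linear_mull | apply: linear_kmull]
        else first [apply: linear_mulr | apply: linear_kmulr]; lin
    | |- GRing.linear_for _ (fun x => \sum_(i <- _ | _) _) =>
        apply: linear_sum; lin
    | |- _ => first
      [ lin_ext; lin
      | solve [auto 1]
      | lazymatch goal with
        | |- GRing.linear_for _ (fun x => ?g x) =>
            first [exact: linearP | apply: linear_form; exact: linear_id]
        end
      | match goal with
        | |- GRing.linear_for _ (fun x => ?g (@?f x)) =>
            not_id f;
            first [apply: linear_form
                  | apply: (@linear_comp _ _ _ _ g)]
        | |- GRing.linear_for _ (fun x => ?g (@?a x) ?b) =>
            not_id a; apply: (@linear_comp _ _ _ _ (fun y => g y b))
        | |- GRing.linear_for _ (fun x => ?g (@?a x) ?b ?c) =>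
            not_id a; apply: (@linear_comp _ _ _ _ (fun y => g y b c))
        end; lin ]
    end
  end.

(** * Sweedler sums under linear maps, exchange and nesting *)

Section Sweedler.
Context {k : comNzRingType}.
Implicit Types (V W U X Y : lmodType k).

Lemma eq_tlift V W (U : nmodType) (f g : V -> W -> U) (t : {tensor V & W}) :
  (forall v w, f v w = g v w) -> tlift f t = tlift g t.
Proof. by move=> e; apply: eq_bigr => p _; apply: e. Qed.

Lemma linear_fun0 V U (L : V -> U) : linear L -> L 0 = 0.
Proof. by move=> lL; have := lL (-1) 0 0; rewrite !scaleN1r !addNr. Qed.

Lemma linear_funD V U (L : V -> U) : linear L -> {morph L : x y / x + y}.
Proof. by move=> lL x y; have := lL 1 x y; rewrite !scale1r. Qed.

Lemma linear_funZ V U (L : V -> U) a x : linear L -> L (a *: x) = a *: L x.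
Proof. by move=> lL; have := lL a x 0; rewrite (linear_fun0 lL) !addr0. Qed.

Lemma linear_fun_sum V U (L : V -> U) (I : Type) (s : seq I) (Q : pred I) F :
  linear L -> L (\sum_(i <- s | Q i) F i) = \sum_(i <- s | Q i) L (F i).
Proof.
by move=> lL; apply: big_morph; [exact: linear_funD | exact: linear_fun0].
Qed.

Lemma linear_tlift V W X U (L : X -> U) (f : V -> W -> X) (t : {tensor V & W}) :
  linear L -> L (tlift f t) = tlift (fun v w => L (f v w)) t.
Proof. exact: linear_fun_sum. Qed.

Lemma exchange_tlift V W X Y (U : nmodType) (f : V -> W -> X -> Y -> U) s t :
  tlift (fun v w => tlift (f v w) t) s =
  tlift (fun x y => tlift (fun v w => f v w x y) s) t.
Proof. exact: exchange_big. Qed.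

Lemma tlift_sum V W (U : nmodType) (I : Type) (s : seq I) (Q : pred I)
    (F : I -> V -> W -> U) t :
  tlift (fun v w => \sum_(i <- s | Q i) F i v w) t =
  \sum_(i <- s | Q i) tlift (F i) t.
Proof. exact: exchange_big. Qed.

Lemma tlift_tlift V W X Y U (g : X -> Y -> U) (f : V -> W -> {tensor X & Y}) t :
  bilinear_for *:%R *:%R g ->
  tlift g (tlift f t) = tlift (fun v w => tlift g (f v w)) t.
Proof. by move=> bg; apply: linear_tlift; apply: tlift_linear. Qed.

Lemma tensorE V W (t : {tensor V & W}) : \sw_(v, w <- t) v *t w = t.
Proof.
apply: (tensor_ind (P := fun t => tlift tens t = t)).
  apply: linear_fun0. lin. 
move=> v w x IH; rewrite linear_funD; last by lin.
by rewrite IH tlift_tens //; lin.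
Qed.

End Sweedler.

Section Sweedler2.
Context {k : comNzRingType}.
Implicit Types (V W U X Y Z : lmodType k).

Lemma tensor_ext V W U (f g : {tensor V & W} -> U) :
  linear f -> linear g -> (forall v w, f (v *t w) = g (v *t w)) -> f =1 g.
Proof.
move=> lf lg e; apply: tensor_ind => [|v w x IH]; first by rewrite !linear_fun0.
by rewrite !linear_funD // e IH.
Qed.

Lemma scale_tlift V W U (f : V -> W -> k) (t : {tensor V & W}) (u : U) :
  tlift f t *: u = tlift (fun v w => f v w *: u) t.
Proof. exact: scaler_suml. Qed.

Lemma scaler_tlift V W U (f : V -> W -> U) (t : {tensor V & W}) (a : k) :
  a *: tlift f t = tlift (fun v w => a *: f v w) t.
Proof. exact: scaler_sumr. Qed.

Lemma mul_tlift V W (C : nzRingType) (f : V -> W -> C) (t : {tensor V & W}) c :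
  tlift f t * c = tlift (fun v w => f v w * c) t.
Proof. exact: mulr_suml. Qed.

Lemma mulr_tlift V W (C : nzRingType) (f : V -> W -> C) (t : {tensor V & W}) c :
  c * tlift f t = tlift (fun v w => c * f v w) t.
Proof. exact: mulr_sumr. Qed.

(** The linear map on a triple tensor product induced by F. It carries axioms stated in such a
    product over to arbitrary trilinear expressions. *)
Definition lift3 V W X U (F : V -> W -> X -> U)
    (t : {tensor {tensor V & W} & X}) : U :=
  \sw_(vw, x <- t) \sw_(v, w <- vw) F v w x.

Section Lift3.
Context {V W X U : lmodType k} {F : V -> W -> X -> U}.
Hypothesis triF : trilinear F.

Let linF1 w x : linear (fun v => F v w x). Proof. by case: triF. Qed.
Let linF2 v x : linear (fun w => F v w x). Proof. by case: triF. Qed.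
Let linF3 v w : linear (fun x => F v w x). Proof. by case: triF. Qed.

Lemma lift3_linear : linear (lift3 F).
Proof. by rewrite /lift3; lin. Qed.

Lemma lift3_tens v w x : lift3 F (v *t w *t x) = F v w x.
Proof. by rewrite /lift3 tlift_tens ?tlift_tens //; lin. Qed.

Lemma lift3_sw Y1 Y2 Z1 Z2 (s : {tensor Y1 & Y2})
    (g : Y1 -> Y2 -> {tensor Z1 & Z2})
    (h : Y1 -> Y2 -> Z1 -> Z2 -> {tensor {tensor V & W} & X}) :
  lift3 F (\sw_(x, y <- s) \sw_(z, w <- g x y) h x y z w) =
  \sw_(x, y <- s) \sw_(z, w <- g x y) lift3 F (h x y z w).
Proof.
rewrite linear_tlift; last exact: lift3_linear.
by apply: eq_tlift => x y; rewrite linear_tlift //; apply: lift3_linear.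
Qed.

Lemma lift3_sw1 Y1 Y2 (s : {tensor Y1 & Y2})
    (h : Y1 -> Y2 -> {tensor {tensor V & W} & X}) :
  lift3 F (\sw_(x, y <- s) h x y) = \sw_(x, y <- s) lift3 F (h x y).
Proof. by rewrite linear_tlift //; apply: lift3_linear. Qed.

End Lift3.
End Sweedler2.


(** * Coassociativity for trilinear expressions, and the form r at the unit *)

Section Bialgebra.
Context {k : comNzRingType} {H : algType k} (h : bialg H).

(** The axiom [comulA] is the universal case, with values in the triple tensor product; applying
    [lift3 F] specializes it. *)
Lemma comulA_sw (U : lmodType k) (F : H -> H -> H -> U) a : trilinear F ->
  \sw_(x, y <- comul h a) \sw_(y1, y2 <- comul h y) F x y1 y2 =
  \sw_(x, y <- comul h a) \sw_(x1, x2 <- comul h x) F x1 x2 y.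
Proof.
move=> tF; have /(congr1 (lift3 F)) := comulA h a; rewrite !lift3_sw //.
by under eq_tlift do under eq_tlift do rewrite lift3_tens //;
  under [X in _ = X -> _]eq_tlift do under eq_tlift do rewrite lift3_tens //.
Qed.

Lemma coactA_sw (V : algType k) (c : comodalg h V) (U : lmodType k)
    (F : V -> H -> H -> U) v : trilinear F ->
  \sw_(v1, a <- c v) \sw_(v2, b <- c v1) F v2 b a =
  \sw_(v1, a <- c v) \sw_(a1, a2 <- comul h a) F v1 a1 a2.
Proof.
move=> tF; have /(congr1 (lift3 F)) := coactA c v; rewrite !lift3_sw //.
by under eq_tlift do under eq_tlift do rewrite lift3_tens //;
  under [X in _ = X -> _]eq_tlift do under eq_tlift do rewrite lift3_tens //.
Qed.

Lemma bcomulA_sw (r : dqt h) (B : algType k) (b : bbialg r B) (U : lmodType k)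
    (F : B -> B -> B -> U) a : trilinear F ->
  \sw_(x, y <- bcomul b a) \sw_(y1, y2 <- bcomul b y) F x y1 y2 =
  \sw_(x, y <- bcomul b a) \sw_(x1, x2 <- bcomul b x) F x1 x2 y.
Proof.
move=> tF; have /(congr1 (lift3 F)) := bcomulA b a; rewrite !lift3_sw //.
by under eq_tlift do under eq_tlift do rewrite lift3_tens //;
  under [X in _ = X -> _]eq_tlift do under eq_tlift do rewrite lift3_tens //.
Qed.

Variable r : dqt h.

(** A convolution idempotent with a right inverse is the unit: f = f * (f * f') = (f * f) * f' = f *
    f'. *)
Lemma conv_idem (f f' : H -> k^o) a : linear f -> linear f' ->
    (forall x, \sw_(x1, x2 <- comul h x) f x1 * f x2 = f x) ->
    (forall x, \sw_(x1, x2 <- comul h x) f x1 * f' x2 = counit h x) ->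
  f a = counit h a.
Proof.
move=> lf lf' ff ff'; rewrite -[in RHS]ff'.
transitivity (\sw_(x, y <- comul h a) \sw_(y1, y2 <- comul h y)
                (f x * (f y1 * f' y2) : k^o)).
  rewrite -[a in LHS](counitr h) (linear_tlift _ _ lf).
  apply: eq_tlift => x y; rewrite (linear_funZ _ _ lf).
  rewrite [LHS](mulrC (counit h y) (f x)) -ff'; exact: mulr_tlift.
rewrite (comulA_sw (F := fun x y z => f x * (f y * f' z) : k^o)); last by lin.
apply: eq_tlift => x y; rewrite -ff mul_tlift.
by apply: eq_tlift => x1 x2; apply: mulrA.
Qed.

(** As 1 = 1 * 1, [dqtMr] makes this functional a convolution idempotent, and the inverse of r
    restricts to a right inverse of it. *)
Lemma dqt1r a : r (a *t 1) = counit h a.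
Proof.
have [g gP] := dqt_inv r.
apply: (conv_idem (f := fun x => r (x *t 1)) (f' := fun x => g (x *t 1)))
  => [||x|x].
- by lin.
- by lin.
- by rewrite -[in RHS](mulr1 1) dqtMr.
have := (gP x 1).1; rewrite /convolution comul1 rmorph1 mulr1 => <-.
by apply: eq_tlift => x1 x2; rewrite (tlift_tens (U := k^o)) //; lin.
Qed.

Lemma dqt1l a : r (1 *t a) = counit h a.
Proof.
have [g gP] := dqt_inv r.
apply: (conv_idem (f := fun x => r (1 *t x)) (f' := fun x => g (1 *t x)))
  => [||x|x].
- by lin.
- by lin.
- by rewrite -[in RHS](mulr1 1) dqtMl.
have := (gP 1 x).1; rewrite /convolution comul1 rmorph1 mul1r => <-.
by rewrite (tlift_tens (U := k^o)) //; lin.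
Qed.

End Bialgebra.

Arguments comulA_sw {k H} h {U} F a _.
Arguments coactA_sw {k H h V} c {U} F v _.
Arguments bcomulA_sw {k H h r B} b {U} F a _.

(** * The two actions of A on comodules defined by r *)

Section Ops.
Context {k : comNzRingType} {H : algType k} {h : bialg H} (r : dqt h).

(* Through r, each element of A acts on every comodule in two ways:
   on the right by [rho] and on the left by [lam]. *)
Definition rho (V : algType k) (c : comodalg h V) (a : H) (v : V) : V :=
  \sw_(v1, b <- c v) r (b *t a) *: v1.

Definition lam (V : algType k) (c : comodalg h V) (a : H) (v : V) : V :=
  \sw_(v1, b <- c v) r (a *t b) *: v1.

Lemma linear_rhol (X : lmodType k) (V : algType k) (c : comodalg h V)
    (f : X -> H) v : linear f -> linear (fun x => rho c (f x) v).
Proof. by move=> lf; rewrite /rho; lin. Qed.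

Lemma linear_rhor (X : lmodType k) (V : algType k) (c : comodalg h V)
    (f : X -> V) a : linear f -> linear (fun x => rho c a (f x)).
Proof. by move=> lf; rewrite /rho; lin. Qed.

Lemma linear_laml (X : lmodType k) (V : algType k) (c : comodalg h V)
    (f : X -> H) v : linear f -> linear (fun x => lam c (f x) v).
Proof. by move=> lf; rewrite /lam; lin. Qed.

Lemma linear_lamr (X : lmodType k) (V : algType k) (c : comodalg h V)
    (f : X -> V) a : linear f -> linear (fun x => lam c a (f x)).
Proof. by move=> lf; rewrite /lam; lin. Qed.
End Ops.

Ltac lin_ext ::=
  lazymatch goal with
  | |- GRing.linear_for _ (fun x => rho _ _ _ (@?v x)) =>
      tryif is_cst v then apply: linear_rhol else apply: linear_rhor
  | |- GRing.linear_for _ (fun x => lam _ _ _ (@?v x)) =>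
      tryif is_cst v then apply: linear_laml else apply: linear_lamr
  end.

Section OpsTheory.
Context {k : comNzRingType} {H : algType k} {h : bialg H} (r : dqt h).
Section One.
Context {V : algType k} (c : comodalg h V).
Local Notation rho := (rho r).
Local Notation lam := (lam r).

Lemma rho_mul a b v : rho c (a * b) v = rho c b (rho c a v).
Proof.
rewrite {3}/rho linear_tlift; last by lin.
transitivity (\sw_(v1, x <- c v) \sw_(x1, x2 <- comul h x)
   (r (x1 *t b) * r (x2 *t a)) *: v1).
  by apply: eq_tlift => v1 x; rewrite dqtMr scale_tlift.
rewrite -(coactA_sw c (fun v x1 x2 => (r (x1 *t b) * r (x2 *t a)) *: v));
  last by lin.
apply: eq_tlift => v1 x; rewrite linear_funZ; last by lin.
rewrite scaler_tlift; apply: eq_tlift => v2 y.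
by rewrite scalerA mulrC.
Qed.

Lemma lam_mul a b v : lam c (a * b) v = lam c a (lam c b v).
Proof.
rewrite {3}/lam linear_tlift; last by lin.
transitivity (\sw_(v1, x <- c v) \sw_(x1, x2 <- comul h x)
   (r (a *t x1) * r (b *t x2)) *: v1).
  by apply: eq_tlift => v1 x; rewrite dqtMl scale_tlift.
rewrite -(coactA_sw c (fun v x1 x2 => (r (a *t x1) * r (b *t x2)) *: v));
  last by lin.
apply: eq_tlift => v1 x; rewrite linear_funZ; last by lin.
rewrite scaler_tlift; apply: eq_tlift => v2 y.
by rewrite scalerA mulrC.
Qed.

Lemma rho1 v : rho c 1 v = v.
Proof.
rewrite -[RHS](coact_counit c); apply: eq_tlift => v1 a.
by rewrite dqt1r.
Qed.

Lemma lam1 v : lam c 1 v = v.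
Proof.
rewrite -[RHS](coact_counit c); apply: eq_tlift => v1 a.
by rewrite dqt1l.
Qed.

Lemma rho_one a : rho c a 1 = counit h a *: 1.
Proof. by rewrite /rho coact1 tlift_tens ?dqt1l //; lin. Qed.

Lemma lam_one a : lam c a 1 = counit h a *: 1.
Proof. by rewrite /lam coact1 tlift_tens ?dqt1r //; lin. Qed.

(** Multiplicativity of r in its first argument makes V a module algebra under [rho]. *)
Lemma rhoM a v w : rho c a (v * w) =
  \sw_(a1, a2 <- comul h a) rho c a1 v * rho c a2 w.
Proof.
rewrite {1}/rho coactM tlift_tlift; last by lin.
transitivity (\sw_(v1, b1 <- c v) \sw_(w1, b2 <- c w) \sw_(a1, a2 <- comul h a)
  (r (b1 *t a1) * r (b2 *t a2)) *: (v1 * w1)).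
  apply: eq_tlift => v1 b1; rewrite tlift_tlift; last by lin.
  apply: eq_tlift => w1 b2; rewrite tlift_tens; last by lin.
  by rewrite dqtMl scale_tlift.
under eq_tlift do rewrite exchange_tlift; rewrite exchange_tlift.
apply: eq_tlift => a1 a2; rewrite mul_tlift; apply: eq_tlift => v1 b1.
rewrite mulr_tlift; apply: eq_tlift => w1 b2.
by rewrite -scalerAl -scalerAr scalerA.
Qed.

(** [dqtMr] reverses products, which is why the second leg of the coproduct acts on the first
    factor. *)
Lemma lamM a v w : lam c a (v * w) =
  \sw_(a1, a2 <- comul h a) lam c a2 v * lam c a1 w.
Proof.
rewrite {1}/lam coactM tlift_tlift; last by lin.
transitivity (\sw_(v1, b1 <- c v) \sw_(w1, b2 <- c w) \sw_(a1, a2 <- comul h a)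
  (r (a1 *t b2) * r (a2 *t b1)) *: (v1 * w1)).
  apply: eq_tlift => v1 b1; rewrite tlift_tlift; last by lin.
  apply: eq_tlift => w1 b2; rewrite tlift_tens; last by lin.
  by rewrite dqtMr scale_tlift.
under eq_tlift do rewrite exchange_tlift; rewrite exchange_tlift.
apply: eq_tlift => a1 a2; rewrite mul_tlift; apply: eq_tlift => v1 b1.
rewrite mulr_tlift; apply: eq_tlift => w1 b2.
by rewrite -scalerAl -scalerAr scalerA mulrC.
Qed.
End One.

End OpsTheory.

(** * The braided tensor product algebra *)

Section TensSw.
Context {k : comNzRingType} {V W X Y : lmodType k}.

Lemma tens_tlift (f : X -> Y -> V) t (w : W) :
  tlift f t *t w = tlift (fun x y => f x y *t w) t.
Proof. by apply: (linear_tlift (L := fun v => v *t w)); lin. Qed.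

Lemma tensr_tlift (f : X -> Y -> W) t (v : V) :
  v *t tlift f t = tlift (fun x y => v *t f x y) t.
Proof. by apply: linear_tlift; lin. Qed.

Lemma tensZl a (v : V) (w : W) : (a *: v) *t w = a *: (v *t w).
Proof. by apply: (linear_funZ (L := fun v => v *t w)); lin. Qed.

Lemma tensZr a (v : V) (w : W) : v *t (a *: w) = a *: (v *t w).
Proof. by apply: linear_funZ; lin. Qed.

End TensSw.

Section Bmul.
Context {k : comNzRingType} {H : algType k} {h : bialg H} (r : dqt h).
Context {V W : algType k} (c : comodalg h V) (d : comodalg h W).

(** Absorbing the coaction of w into [rho] leaves one coaction in the braiding; properties of the
    braided product then come from those of the action. *)
Lemma braiding_tens w v :
  braiding r d c (w *t v) = \sw_(v1, a <- c v) v1 *t rho r d a w.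
Proof.
rewrite /braiding tlift_tens; last by lin.
rewrite exchange_tlift; apply: eq_tlift => v1 a.
rewrite [RHS]linear_tlift; last by lin.
by apply: eq_tlift => w1 b; rewrite [RHS]linear_funZ //; lin.
Qed.

Lemma bmulE x y : bmul r c d x y =
  \sw_(v, w <- x) \sw_(u, z <- y) \sw_(u1, a <- c u)
    (v * u1) *t (rho r d a w * z).
Proof.
apply: eq_tlift => v w; apply: eq_tlift => u z; rewrite braiding_tens.
rewrite tlift_tlift; last by lin.
by apply: eq_tlift => u1 a; rewrite tlift_tens //; lin.
Qed.

Lemma linear_bmull (X : lmodType k) (f : X -> {tensor V & W}) y :
  linear f -> linear (fun x => bmul r c d (f x) y).
Proof. by move=> lf; rewrite (funext (fun z => bmulE (f z) y)); lin. Qed.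

Lemma linear_bmulr (X : lmodType k) (f : X -> {tensor V & W}) x :
  linear f -> linear (fun y => bmul r c d x (f y)).
Proof. by move=> lf; rewrite (funext (fun z => bmulE x (f z))); lin. Qed.

Lemma bmul_tens v w u z : bmul r c d (v *t w) (u *t z) =
  \sw_(u1, a <- c u) (v * u1) *t (rho r d a w * z).
Proof. by rewrite bmulE tlift_tens ?tlift_tens //; lin. Qed.

Lemma linear_coact_tensor (X : lmodType k) (f : X -> {tensor V & W}) :
  linear f -> linear (fun x => coact_tensor c d (f x)).
Proof. by move=> lf; rewrite /coact_tensor; lin. Qed.

Lemma coact_tensor_tens v w : coact_tensor c d (v *t w) =
  \sw_(v1, a <- c v) \sw_(w1, b <- d w) (v1 *t w1) *t (a * b).
Proof. by rewrite /coact_tensor tlift_tens //; lin. Qed.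

End Bmul.

Ltac lin_ext ::=
  lazymatch goal with
  | |- GRing.linear_for _ (fun x => rho _ _ _ (@?v x)) =>
      tryif is_cst v then apply: linear_rhol else apply: linear_rhor
  | |- GRing.linear_for _ (fun x => lam _ _ _ (@?v x)) =>
      tryif is_cst v then apply: linear_laml else apply: linear_lamr
  | |- GRing.linear_for _ (fun x => bmul _ _ _ _ (@?v x)) =>
      tryif is_cst v then apply: linear_bmull else apply: linear_bmulr
  | |- GRing.linear_for _ (fun x => coact_tensor _ _ _) =>
      apply: linear_coact_tensor
  end.

(** * Associativity and covariance of the braided product *)

Section BmulTheory.
Context {k : comNzRingType} {H : algType k} {h : bialg H} (r : dqt h).
Context {V W : algType k} (c : comodalg h V) (d : comodalg h W).
Local Notation mul := (bmul r c d).

Lemma bmul1l : left_id (1 *t 1) mul.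
Proof.
apply: tensor_ext => [||v w]; [by lin..|].
rewrite bmul_tens (eq_tlift (g := fun u1 a => counit h a *: u1 *t w)).
  by rewrite -[in RHS](coact_counit c v) tens_tlift.
by move=> u1 a; rewrite rho_one mul1r -scalerAl mul1r tensZl tensZr.
Qed.

Lemma bmul1r : right_id (1 *t 1) mul.
Proof.
apply: tensor_ext => [||v w]; [by lin..|].
by rewrite bmul_tens coact1 tlift_tens ?rho1 ?mulr1 //; lin.
Qed.

(** On pure tensors, the coaction of p is applied twice on one side and once on the other.
    Coassociativity of that coaction, [rhoM] and [rho_mul] match the two. *)
Lemma bmulA : associative mul.
Proof.
move=> x y z; move: x.
apply: tensor_ext => [||v w]; [by lin..|]; move: y.
apply: tensor_ext => [||u s]; [by lin..|]; move: z.
apply: tensor_ext => [||p t]; [by lin..|].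
rewrite !bmul_tens (linear_tlift (L := mul _)); last by lin.
rewrite (linear_tlift (L := mul ^~ _)); last by lin.
under [RHS]eq_tlift do rewrite bmul_tens.
transitivity (\sw_(p1, b <- c p) \sw_(p2, b' <- c p1) \sw_(u1, a <- c u)
   (v * (u1 * p2)) *t (rho r d (a * b') w * (rho r d b s * t))).
  apply: eq_tlift => p1 b; rewrite bmul_tens coactM tlift_tlift; last by lin.
  rewrite [RHS]exchange_tlift; apply: eq_tlift => u1 a.
  rewrite tlift_tlift; last by lin.
  by apply: eq_tlift => p2 b'; rewrite tlift_tens //; lin.
rewrite (coactA_sw c (fun p2 b' b => \sw_(u1, a <- c u)
   (v * (u1 * p2)) *t (rho r d (a * b') w * (rho r d b s * t)))); last by lin.
rewrite [RHS]exchange_tlift; apply: eq_tlift => p1 b.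
rewrite exchange_tlift; apply: eq_tlift => u1 a.
rewrite rhoM mul_tlift tensr_tlift.
by apply: eq_tlift => b1 b2; rewrite rho_mul !mulrA.
Qed.

Lemma coact_tensorA x :
  \sw_(v1, a <- coact_tensor c d x) \sw_(v2, b <- coact_tensor c d v1)
    v2 *t b *t a =
  \sw_(v1, a <- coact_tensor c d x) \sw_(a1, a2 <- comul h a)
    v1 *t a1 *t a2.
Proof.
move: x; apply: tensor_ext => [||v w]; [by lin..|].
rewrite !coact_tensor_tens !tlift_tlift; try by lin.
transitivity (\sw_(v1, a <- c v) \sw_(v2, a' <- c v1)
   \sw_(w1, b <- d w) \sw_(w2, b' <- d w1)
   (v2 *t w2) *t (a' * b') *t (a * b)).
  apply: eq_tlift => v1 a; rewrite tlift_tlift; last by lin.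
  rewrite [RHS]exchange_tlift; apply: eq_tlift => w1 b.
  rewrite tlift_tens; last by lin.
  rewrite coact_tensor_tens tlift_tlift; last by lin.
  apply: eq_tlift => v2 a'; rewrite tlift_tlift; last by lin.
  by apply: eq_tlift => w2 b'; rewrite tlift_tens //; lin.
rewrite (coactA_sw c (fun v2 a' a => \sw_(w1, b <- d w) \sw_(w2, b' <- d w1)
   (v2 *t w2) *t (a' * b') *t (a * b))); last by lin.
apply: eq_tlift => v1 a; rewrite [RHS]tlift_tlift; last by lin.
transitivity (\sw_(a1, a2 <- comul h a) \sw_(w1, b <- d w)
   \sw_(b1, b2 <- comul h b) (v1 *t w1) *t (a1 * b1) *t (a2 * b2)).
  apply: eq_tlift => a1 a2.
  rewrite (coactA_sw d (fun w2 b' b =>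
     (v1 *t w2) *t (a1 * b') *t (a2 * b))) //; last by lin.
rewrite exchange_tlift; apply: eq_tlift => w1 b.
rewrite tlift_tens; last by lin.
rewrite comulM tlift_tlift; last by lin.
apply: eq_tlift => a1 a2; rewrite tlift_tlift; last by lin.
by apply: eq_tlift => b1 b2; rewrite tlift_tens //; lin.
Qed.

Lemma coact_tensor_counit x :
  \sw_(v1, a <- coact_tensor c d x) counit h a *: v1 = x.
Proof.
move: x; apply: tensor_ext => [||v w]; [by lin..|].
rewrite coact_tensor_tens tlift_tlift; last by lin.
rewrite -[v in RHS](coact_counit c) tens_tlift; apply: eq_tlift => v1 a.
rewrite -[w in RHS](coact_counit d) tensr_tlift tlift_tlift; last by lin.
apply: eq_tlift => w1 b; rewrite tlift_tens; last by lin.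
by rewrite rmorphM tensZr tensZl scalerA mulrC.
Qed.

Lemma coact_tensor1 : coact_tensor c d (1 *t 1) = 1 *t 1 *t 1.
Proof.
rewrite coact_tensor_tens !coact1 tlift_tens ?tlift_tens ?mulr1 //; lin.
Qed.

(** The braiding is a comodule map: the coaction is taken after it on the left and before it on the
    right. Coassociativity moves all coproducts into A, where [dqtC] applies. *)
Lemma coact_rho (U : lmodType k) (F : V -> W -> H -> U) u w : trilinear F ->
  \sw_(u1, a <- c u) \sw_(u2, a' <- c u1) \sw_(w', b <- d (rho r d a w))
    F u2 w' (a' * b) =
  \sw_(w1, b <- d w) \sw_(u1, a <- c u) \sw_(u2, a' <- c u1)
    F u2 (rho r d a' w1) (b * a).
Proof.
case=> lF1 lF2 lF3.
rewrite (coactA_sw c (fun u2 a' a => \sw_(w', b <- d (rho r d a w))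
    F u2 w' (a' * b))); last by lin.
under [RHS]eq_tlift => w1 b.
  rewrite (coactA_sw c (fun u2 a' a => F u2 (rho r d a' w1) (b * a)));
    last by lin.
  over.
rewrite [RHS]exchange_tlift; apply: eq_tlift => u1 a.
transitivity (\sw_(a1, a2 <- comul h a) \sw_(w1, b <- d w)
  \sw_(w2, b' <- d w1) r (b *t a2) *: F u1 w2 (a1 * b')).
  apply: eq_tlift => a1 a2; rewrite {1}/rho.
  rewrite (linear_tlift (L := d)) ?tlift_tlift; try by lin.
  apply: eq_tlift => w1 b; rewrite linearZ /=.
  rewrite (linear_funZ (L := tlift _)) ?scaler_tlift //; lin.
transitivity (\sw_(a1, a2 <- comul h a) \sw_(w1, b <- d w)
  \sw_(b1, b2 <- comul h b) r (b2 *t a2) *: F u1 w1 (a1 * b1)).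
  apply: eq_tlift => a1 a2.
  by rewrite (coactA_sw d (fun w2 b' b => r (b *t a2) *: F u1 w2 (a1 * b')));
    last by lin.
(* This equality is [dqtC] for b and a, under the linear map [F u1 w1]. *)
transitivity (\sw_(a1, a2 <- comul h a) \sw_(w1, b <- d w)
  \sw_(b1, b2 <- comul h b) r (b1 *t a1) *: F u1 w1 (b2 * a2)).
  rewrite exchange_tlift [RHS]exchange_tlift; apply: eq_tlift => w1 b.
  rewrite exchange_tlift [RHS]exchange_tlift.
  have /(congr1 (F u1 w1)) := dqtC r b a.
  rewrite !(linear_tlift (L := F u1 w1)) //.
  under eq_tlift => b1 b2.
    rewrite (linear_tlift (L := F u1 w1)) //.
    under eq_tlift do rewrite linear_funZ //.
    over.
  move=> ->; apply: eq_tlift => b1 b2.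
  rewrite (linear_tlift (L := F u1 w1)) //.
  by under eq_tlift do rewrite linear_funZ //.
rewrite [RHS]exchange_tlift; apply: eq_tlift => a1 a2.
rewrite -(coactA_sw d (fun w1 b1 b2 => r (b1 *t a1) *: F u1 w1 (b2 * a2)));
  last by lin.
apply: eq_tlift => w1 b; symmetry.
apply: (etrans (linear_tlift _ _ (lF2 u1 (b * a2)))); apply: eq_tlift => w2 b'.
exact: (linear_funZ _ _ (lF2 u1 (b * a2))).
Qed.

(** The coactions of the outer factors v and z multiply directly; for the inner factors w and u,
    [coact_rho] takes the coaction through the braiding. *)
Lemma coact_bmul x y : coact_tensor c d (mul x y) =
  \sw_(x1, a <- coact_tensor c d x) \sw_(y1, b <- coact_tensor c d y)
    mul x1 y1 *t (a * b).
Proof.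
move: x; apply: tensor_ext => [||v w]; [by lin..|].
move: y; apply: tensor_ext => [||u z]; [by lin..|].
rewrite bmul_tens linear_tlift; last by lin.
transitivity (\sw_(v1, a <- c v) \sw_(z1, b <- d z)
  \sw_(u1, a' <- c u) \sw_(u2, a'' <- c u1) \sw_(w1, b' <- d (rho r d a' w))
   (v1 * u2) *t (w1 * z1) *t (a * (a'' * b') * b)).
  transitivity (\sw_(u1, a' <- c u) \sw_(v1, a <- c v) \sw_(u2, a'' <- c u1)
    \sw_(w1, b' <- d (rho r d a' w)) \sw_(z1, b <- d z) 
    (v1 * u2) *t (w1 * z1) *t (a * (a'' * b') * b)).
    apply: eq_tlift => u1 a'.
    rewrite coact_tensor_tens (coactM c) tlift_tlift; last by lin.
    apply: eq_tlift => v1 a; rewrite tlift_tlift; last by lin.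
    apply: eq_tlift => u2 a''; rewrite tlift_tens; last by lin.
    rewrite coactM tlift_tlift; last by lin.
    apply: eq_tlift => w1 b'; rewrite tlift_tlift; last by lin.
    by apply: eq_tlift => z1 b; rewrite tlift_tens ?mulrA //; lin.
  rewrite exchange_tlift; apply: eq_tlift => v1 a.
  rewrite [RHS]exchange_tlift; apply: eq_tlift => u1 a'.
  rewrite [RHS]exchange_tlift; apply: eq_tlift => u2 a''.
  by rewrite [RHS]exchange_tlift.
rewrite !coact_tensor_tens tlift_tlift; last by lin.
apply: eq_tlift => v1 a; rewrite tlift_tlift; last by lin.
transitivity (\sw_(z1, b <- d z)
  \sw_(w1, b' <- d w) \sw_(u1, a' <- c u) \sw_(u2, a'' <- c u1) 
   (v1 * u2) *t (rho r d a'' w1 * z1) *t (a * (b' * a') * b)).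
  apply: eq_tlift => z1 b.
  apply: (coact_rho (F := fun u2 w1 x =>
    (v1 * u2) *t (w1 * z1) *t (a * x * b))).
  by lin.
rewrite exchange_tlift; apply: eq_tlift => w1 b'.
rewrite tlift_tens; last by lin.
rewrite exchange_tlift tlift_tlift; last by lin.
apply: eq_tlift => u1 a'; rewrite tlift_tlift; last by lin.
apply: eq_tlift => z1 b; rewrite tlift_tens; last by lin.
rewrite bmul_tens tens_tlift; apply: eq_tlift => u2 a''.
by rewrite !mulrA.
Qed.

End BmulTheory.

(* The hypothesis [nz] is there because [algType] excludes the zero algebra. *)
Definition bt (k : comNzRingType) (H : algType k) (h : bialg H) (r : dqt h)
    (V W : algType k) (c : comodalg h V) (d : comodalg h W)
    (nz : 1 *t 1 != 0 :> {tensor V & W}) : Type := {tensor V & W}.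

Section BtAlg.
Context {k : comNzRingType} {H : algType k} {h : bialg H} (r : dqt h).
Context {V W : algType k} (c : comodalg h V) (d : comodalg h W).
Variable nz : 1 *t 1 != 0 :> {tensor V & W}.
Local Notation T := (bt r c d nz).

HB.instance Definition _ := GRing.Lmodule.copy T {tensor V & W}.

Let mulDl : left_distributive (bmul r c d : T -> T -> T) +%R.
Proof. by move=> x y z; apply: (linear_funD (L := bmul r c d ^~ z)); lin. Qed.
Let mulDr : right_distributive (bmul r c d : T -> T -> T) +%R.
Proof. by move=> x y z; apply: (linear_funD (L := bmul r c d x)); lin. Qed.

HB.instance Definition _ := GRing.Zmodule_isNzRing.Build T
  (@bmulA _ _ _ r _ _ c d) (bmul1l r c d) (bmul1r r c d) mulDl mulDr nz.

Let scaleAl a (x y : T) : a *: (x * y) = (a *: x) * y.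
Proof. by symmetry; apply: (linear_funZ (L := bmul r c d ^~ y)); lin. Qed.

HB.instance Definition _ := GRing.Lmodule_isLalgebra.Build k T scaleAl.

Let scaleAr a (x y : T) : a *: (x * y) = x * (a *: y).
Proof. by symmetry; apply: (linear_funZ (L := bmul r c d x)); lin. Qed.

HB.instance Definition _ := GRing.Lalgebra_isAlgebra.Build k T scaleAr.

HB.instance Definition _ := @GRing.isLinear.Build k T {tensor T & H} *:%R
  (coact_tensor c d) (linear_coact_tensor c d (@linear_id _ _)).

Definition bt_comodalg : comodalg h T :=
  @Comodalg k H h T (coact_tensor c d) (coact_tensorA c d)
   (coact_tensor_counit c d) (coact_tensor1 c d) (coact_bmul r c d).
End BtAlg.

(** * The action of the matrix of generators of A *)

Local Opaque tlift.

(** * Inverse kernels over a finite index set *)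

Section Kernels.
Context {k : comNzRingType} {T : finType}.
Implicit Types (K : T -> T -> k) (V : lmodType k).

Lemma sum_deltal V (F : T -> V) x : \sum_y (x == y)%:R *: F y = F x.
Proof.
rewrite (bigD1 x) //= eqxx scale1r big1 ?addr0 // => y.
by rewrite eq_sym => /negPf ->; rewrite scale0r.
Qed.

Lemma sum_deltar V (F : T -> V) x : \sum_y (y == x)%:R *: F y = F x.
Proof. by under eq_bigr do rewrite eq_sym; apply: sum_deltal. Qed.

Lemma kernel_cancel V K K' (f : T -> V) x :
    (forall x y, \sum_z K x z * K' z y = (x == y)%:R) ->
  \sum_z K x z *: \sum_y K' z y *: f y = f x.
Proof.
move=> KK'; under eq_bigr do rewrite scaler_sumr.
rewrite exchange_big -[RHS]sum_deltal; apply: eq_bigr => y _ /=.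
by rewrite -KK' scaler_suml; apply: eq_bigr => z _; rewrite scalerA.
Qed.

(** In matrix notation: if K f = g K and K' is inverse to K, then f K' = K' g. *)
Lemma kernel_transfer V K K' (f g : T -> T -> V) x y :
    (forall x y, \sum_z K x z * K' z y = (x == y)%:R) ->
    (forall x y, \sum_z K' x z * K z y = (x == y)%:R) ->
    (forall x y, \sum_z K x z *: f z y = \sum_z K z y *: g x z) ->
  \sum_z K' z y *: f x z = \sum_z K' x z *: g z y.
Proof.
move=> KK' K'K fg.
transitivity (\sum_z K' z y *: \sum_t K' x t *: \sum_s K t s *: f s z).
  by apply: eq_bigr => z _; rewrite kernel_cancel.
under eq_bigr do rewrite scaler_sumr; rewrite exchange_big /=.
apply: eq_bigr => t _; under eq_bigr do rewrite scalerA mulrC -scalerA fg.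
rewrite -scaler_sumr; congr (_ *: _).
rewrite -(kernel_cancel (g t) y (K := fun s z => K' z s)
  (K' := fun s z => K z s)) //.
by move=> a b; under eq_bigr do rewrite mulrC; rewrite KK' eq_sym.
Qed.

End Kernels.

(** * The matrix t, its inverse, and their actions *)

Section Tmatrix.
Context {k : comNzRingType} {n : nat} {A : algType k} {hA : hopf A}.
Context (r : dqt hA) (t : 'I_n -> 'I_n -> A).
Hypothesis t_comul : forall i j, comul hA (t i j) = \sum_a t i a *t t a j.
Hypothesis t_counit : forall i j, counit hA (t i j) = (i == j)%:R.
Local Notation St i j := (antipode hA (t i j)).

Lemma tlift_comul_t (U : lmodType k) (F : A -> A -> U) i j :
  bilinear_for *:%R *:%R F ->
  \sw_(x, y <- comul hA (t i j)) F x y = \sum_a F (t i a) (t a j).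
Proof.
move=> bF; rewrite t_comul (linear_fun_sum (L := tlift F)); last by lin.
by apply: eq_bigr => a _; rewrite tlift_tens.
Qed.

Lemma St_t i j : \sum_a St i a * t a j = (i == j)%:R *: 1.
Proof. by rewrite -t_counit -antipodel tlift_comul_t //; lin. Qed.

Lemma t_St i j : \sum_a t i a * St a j = (i == j)%:R *: 1.
Proof. by rewrite -t_counit -antipoder tlift_comul_t //; lin. Qed.

Section Action.
Context {V : algType k} (c : comodalg hA V).
Local Notation rho := (rho r c).
Local Notation lam := (lam r c).
Implicit Types v w : V.

Lemma lam_linear a : linear (lam a). Proof. by lin. Qed.

Lemma lam_St_t i j v : \sum_a lam (St i a) (lam (t a j) v) = (i == j)%:R *: v.
Proof.
under eq_bigr do rewrite -lam_mul.
rewrite -(linear_fun_sum _ _ _ (L := lam ^~ v)); last by lin.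
by rewrite St_t (linear_funZ (L := lam ^~ v)) ?lam1 //; lin.
Qed.

Lemma lam_t_St i j v : \sum_a lam (t i a) (lam (St a j) v) = (i == j)%:R *: v.
Proof.
under eq_bigr do rewrite -lam_mul.
rewrite -(linear_fun_sum _ _ _ (L := lam ^~ v)); last by lin.
by rewrite t_St (linear_funZ (L := lam ^~ v)) ?lam1 //; lin.
Qed.

Lemma rho_t_St i j v : \sum_a rho (St a j) (rho (t i a) v) = (i == j)%:R *: v.
Proof.
under eq_bigr do rewrite -rho_mul.
rewrite -(linear_fun_sum _ _ _ (L := rho ^~ v)); last by lin.
by rewrite t_St (linear_funZ (L := rho ^~ v)) ?rho1 //; lin.
Qed.

Lemma lam_tM i j v w :
  lam (t i j) (v * w) = \sum_a lam (t a j) v * lam (t i a) w.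
Proof. by rewrite lamM tlift_comul_t //; lin. Qed.

Lemma rho_tM i j v w :
  rho (t i j) (v * w) = \sum_a rho (t i a) v * rho (t a j) w.
Proof. by rewrite rhoM tlift_comul_t //; lin. Qed.

(* The operators [lam (t i j)] and [lam (St i j)] form inverse matrices, so the
   claim follows from [lam_tM] without computing the coproduct of S. *)
Lemma lam_StM i j v w :
  lam (St i j) (v * w) = \sum_a lam (St i a) v * lam (St a j) w.
Proof.
pose Y i := \sum_a lam (St i a) v * lam (St a j) w.
have YE x : \sum_i lam (t x i) (Y i) = (x == j)%:R *: (v * w).
  rewrite scalerAr -lam_t_St mulr_sumr.
  transitivity (\sum_i \sum_a \sum_b
    lam (t b i) (lam (St i a) v) * lam (t x b) (lam (St a j) w)).
    apply: eq_bigr => i' _.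
    rewrite (linear_fun_sum _ _ _ (lam_linear (t x i'))).
    by apply: eq_bigr => a _; rewrite lam_tM.
  rewrite exchange_big; apply: eq_bigr => a _ /=.
  rewrite exchange_big.
  rewrite -[RHS](sum_deltar (fun b => v * lam (t x b) (lam (St a j) w))).
  apply: eq_bigr => b _ /=.
  by rewrite -mulr_suml lam_t_St -scalerAl.
transitivity (\sum_x lam (St i x) (\sum_i lam (t x i) (Y i))).
  rewrite -[LHS](sum_deltar (fun x => lam (St i x) (v * w))).
  apply: eq_bigr => x _; rewrite YE.
  by rewrite (linear_funZ _ _ (lam_linear (St i x))).
rewrite -[RHS](sum_deltal Y).
transitivity (\sum_x \sum_b lam (St i x) (lam (t x b) (Y b))).
  apply: eq_bigr => x _.
  by rewrite (linear_fun_sum _ _ _ (lam_linear (St i x))).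
by rewrite exchange_big; apply: eq_bigr => b _ /=; rewrite lam_St_t.
Qed.

(** These are the matrices P and L. The action of [t i j] by [lam] reverses the order of factors;
    the antipode in [lam_mx] restores it, so that both matrices are multiplicative. *)
Definition rho_mx v : 'M[V]_n := \matrix_(i, j) rho (t i j) v.
Definition lam_mx v : 'M[V]_n := \matrix_(i, j) lam (St i j) v.

Lemma rho_mxM v w : rho_mx (v * w) = rho_mx v *m rho_mx w.
Proof.
apply/matrixP => i j; rewrite !mxE rho_tM.
by apply: eq_bigr => a _; rewrite !mxE.
Qed.

Lemma lam_mxM v w : lam_mx (v * w) = lam_mx v *m lam_mx w.
Proof.
apply/matrixP => i j; rewrite !mxE lam_StM.
by apply: eq_bigr => a _; rewrite !mxE.
Qed.

Lemma counit_St i j : counit hA (St i j) = (i == j)%:R.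
Proof.
have : counit hA (\sum_a St i a * t a j) = (i == j)%:R.
  by rewrite St_t linearZ rmorph1 /=; apply: mulr1.
rewrite rmorph_sum => <-.
transitivity (\sum_a (a == j)%:R *: (counit hA (St i a) : k^o)).
  by rewrite sum_deltar.
by apply: eq_bigr => a _; rewrite rmorphM /= t_counit; apply: mulrC.
Qed.

Lemma rho_mx1 : rho_mx 1 = 1%:M.
Proof. by apply/matrixP => i j; rewrite !mxE rho_one t_counit scaler_nat. Qed.

Lemma lam_mx1 : lam_mx 1 = 1%:M.
Proof. by apply/matrixP => i j; rewrite !mxE lam_one counit_St scaler_nat. Qed.

Lemma rho_mxD v w : rho_mx (v + w) = rho_mx v + rho_mx w.
Proof. by apply/matrixP => i j; rewrite !mxE linear_funD //; lin. Qed.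

Lemma lam_mxD v w : lam_mx (v + w) = lam_mx v + lam_mx w.
Proof. by apply/matrixP => i j; rewrite !mxE linear_funD //; lin. Qed.

Lemma rho_mxZ a v : rho_mx (a *: v) = map_mx ( *:%R a) (rho_mx v).
Proof. by apply/matrixP => i j; rewrite !mxE linear_funZ //; lin. Qed.

Lemma lam_mxZ a v : lam_mx (a *: v) = map_mx ( *:%R a) (lam_mx v).
Proof. by apply/matrixP => i j; rewrite !mxE linear_funZ //; lin. Qed.

End Action.

(** Closed by [Defined] so that its coaction computes to [comul hA] in [counit_lam]. *)
Definition regular_comodalg : comodalg hA A.
Proof.
by apply: (@Comodalg k A hA A (comul hA));
  [move=> v; rewrite comulA | exact: counitr | exact: comul1 | exact: comulM].
Defined.

(* On the regular comodule, [lam] recovers r; this turns [lam_StM] into an identity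
   for r. *)
Lemma counit_lam x a : counit hA (lam r regular_comodalg x a) = r (x *t a).
Proof.
rewrite /lam (linear_tlift (U := k^o)); last by lin.
have lr : linear (fun y => r (x *t y) : k^o) by lin.
rewrite -[a in RHS](counitl hA) [RHS](linear_tlift _ _ lr).
apply: eq_tlift => y z; rewrite (linear_funZ _ _ lr) linearZ.
exact: mulrC.
Qed.

Lemma dqt_StM i j a b :
  r (St i j *t (a * b)) = \sum_c r (St i c *t a) * r (St c j *t b).
Proof.
rewrite -counit_lam lam_StM rmorph_sum; apply: eq_bigr => c _.
by rewrite rmorphM /= !counit_lam.
Qed.

(** The R-matrix and its inverse, as kernels on pairs of indices. *)
Let R (x y : 'I_n * 'I_n) : k := r (t x.1 y.1 *t t x.2 y.2).
Let Rv (x y : 'I_n * 'I_n) : k := r (St x.1 y.1 *t t x.2 y.2).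


Lemma dqt_tMl a b i j :
  r ((a * b) *t t i j) = \sum_c r (a *t t i c) * r (b *t t c j).
Proof. by rewrite dqtMl (tlift_comul_t (U := k^o)) //; lin. Qed.

Lemma sum_pair (U : nmodType) (F : 'I_n -> 'I_n -> U) :
  \sum_(z : 'I_n * 'I_n) F z.1 z.2 = \sum_a \sum_b F a b.
Proof. by rewrite pair_big. Qed.

(** Multiplicativity of r in its first argument collects t and its antipode image there, and their
    matrix product is the identity. *)
Lemma RRv x y : \sum_z R x z * Rv z y = (x == y)%:R.
Proof.
rewrite (sum_pair (fun a b =>
  r (t x.1 a *t t x.2 b) * r (St a y.1 *t t b y.2))).
have lr : linear (fun z => r (z *t t x.2 y.2) : k^o) by lin.
transitivity (r ((\sum_a t x.1 a * St a y.1) *t t x.2 y.2)).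
  rewrite (linear_fun_sum _ _ _ lr); apply: eq_bigr => a _.
  by rewrite dqt_tMl.
rewrite t_St (linear_funZ _ _ lr) dqt1l t_counit.
by rewrite -[LHS]natrM mulnb.
Qed.

Lemma RvR x y : \sum_z Rv x z * R z y = (x == y)%:R.
Proof.
rewrite (sum_pair (fun a b =>
  r (St x.1 a *t t x.2 b) * r (t a y.1 *t t b y.2))).
have lr : linear (fun z => r (z *t t x.2 y.2) : k^o) by lin.
transitivity (r ((\sum_a St x.1 a * t a y.1) *t t x.2 y.2)).
  rewrite (linear_fun_sum _ _ _ lr); apply: eq_bigr => a _.
  by rewrite dqt_tMl.
rewrite St_t (linear_funZ _ _ lr) dqt1l t_counit.
by rewrite -[LHS]natrM mulnb.
Qed.

(** The kernel X on the left is inverse to [Rv], because t cancels against its antipode image in the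
    second argument of r. So X is R, by uniqueness of inverses. *)
Lemma dqt_StSt i j a b : r (St i j *t St a b) = r (t i j *t t a b).
Proof.
pose X (x y : 'I_n * 'I_n) : k^o := r (St x.1 y.1 *t St x.2 y.2).
have RvX x y : \sum_z Rv x z *: X z y = (x == y)%:R.
  rewrite (sum_pair (fun a b =>
    r (St x.1 a *t t x.2 b) *: (r (St a y.1 *t St b y.2) : k^o))).
  have lr : linear (fun z => r (St x.1 y.1 *t z) : k^o) by lin.
  transitivity (r (St x.1 y.1 *t (\sum_a t x.2 a * St a y.2))).
    rewrite (linear_fun_sum _ _ _ lr) exchange_big; apply: eq_bigr => c _ /=.
    by rewrite dqt_StM.
  rewrite t_St (linear_funZ _ _ lr) dqt1r counit_St.
  by rewrite -[LHS]natrM mulnC mulnb.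
change (X (i, a) (j, b) = R (i, a) (j, b)).
rewrite -(kernel_cancel (X ^~ (j, b)) (i, a) RRv).
under eq_bigr do rewrite RvX.
transitivity (\sum_z (z == (j, b))%:R *: (R (i, a) z : k^o)).
  by apply: eq_bigr => z _; apply: mulrC.
by rewrite sum_deltar.
Qed.

(** * The relation u L(w) = P(w) u *)

Section Commutation.
Context {V : algType k} (c : comodalg hA V) (u : 'M[V]_n).
Hypothesis u_coact : forall i j,
  c (u i j) = \sum_a \sum_b u a b *t (St i a * t b j).
Hypothesis u_rel : forall i j p q,
  \sum_a \sum_b \sum_d \sum_e
    (r (t p b *t t i a) * r (t d j *t t b e)) *: (u a d * u e q) =
  \sum_a \sum_b \sum_d \sum_e
    (r (t b e *t t i a) * r (t d j *t t e q)) *: (u p b * u a d).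

Lemma tlift_coact_u (U : lmodType k) (F : V -> A -> U) i j :
  bilinear_for *:%R *:%R F ->
  \sw_(x, a <- c (u i j)) F x a = \sum_a \sum_b F (u a b) (St i a * t b j).
Proof.
move=> bF; rewrite u_coact linear_fun_sum; last by lin.
apply: eq_bigr => a _; rewrite linear_fun_sum; last by lin.
by apply: eq_bigr => b _; rewrite tlift_tens.
Qed.

(** These are the entries of R_12 u_2 R_12^-1: [dqt_StM] splits r over the two factors of the
    coaction, and [dqt_StSt] identifies one value as R. *)
Lemma lam_u i j x y : lam r c (St i j) (u x y) =
  \sum_e \sum_d \sum_a (Rv (e, d) (j, y) * R (i, x) (e, a)) *: u a d.
Proof.
rewrite /lam tlift_coact_u; last by lin.
under eq_bigr do under eq_bigr do rewrite dqt_StM scaler_suml.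
rewrite exchange_big [RHS]exchange_big; apply: eq_bigr => d _ /=.
rewrite exchange_big; apply: eq_bigr => e _; apply: eq_bigr => a _ /=.
by rewrite dqt_StSt mulrC.
Qed.

(** These are the entries of R_21^-1 u_2 R_21. *)
Lemma rho_u i j x y : rho r c (t i j) (u x y) =
  \sum_a \sum_e \sum_b (Rv (x, i) (a, e) * R (b, e) (y, j)) *: u a b.
Proof.
rewrite /rho tlift_coact_u; last by lin.
under eq_bigr do under eq_bigr do rewrite dqt_tMl scaler_suml.
by apply: eq_bigr => a _; rewrite exchange_big.
Qed.

(* Moving the outer factors R of the relations of B(R) to the other side gives
   u_1 (R_12 u_2 R_12^-1) = (R_21^-1 u_2 R_21) u_1, whose brackets are the images
   of u_2 under [lam_mx] and [rho_mx]. *)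
Lemma comm_u_lam_gen x y : u *m lam_mx c (u x y) = rho_mx c (u x y) *m u.
Proof.
(* f and g are u_1 R_12 u_2 and u_2 R_21 u_1. Row pairs list the index of the second copy first and
   column pairs that of the first copy, so the relations read R f = g R with a single kernel R. *)
pose f (s w : 'I_n * 'I_n) : V :=
  \sum_d \sum_e R (d, s.1) (w.1, e) *: (u s.2 d * u e w.2).
pose g (s w : 'I_n * 'I_n) : V :=
  \sum_a \sum_b R (b, s.2) (w.2, a) *: (u s.1 b * u a w.1).
have fg s w : \sum_z R s z *: f z w = \sum_z R z w *: g s z.
  case: s w => p i [j q]; have := u_rel i j p q.
  rewrite exchange_big /=.
  rewrite -(sum_pair (fun b a => \sum_d \sum_e
    (r (t p b *t t i a) * r (t d j *t t b e)) *: (u a d * u e q))) => E.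
  transitivity (\sum_(z : 'I_n * 'I_n) \sum_d \sum_e
    (r (t p z.1 *t t i z.2) * r (t d j *t t z.1 e)) *: (u z.2 d * u e q)).
    apply: eq_bigr => z _; rewrite scaler_sumr; apply: eq_bigr => d _.
    by rewrite scaler_sumr; apply: eq_bigr => e _; rewrite scalerA.
  rewrite E.
  rewrite (sum_pair (fun d e => R (d, e) (j, q) *: g (p, i) (d, e))).
  under [RHS]eq_bigr do under eq_bigr do rewrite scaler_sumr.
  under [RHS]eq_bigr do rewrite exchange_big.
  rewrite [RHS]exchange_big; apply: eq_bigr => a _ /=.
  under [RHS]eq_bigr do under eq_bigr do rewrite scaler_sumr.
  under [RHS]eq_bigr do rewrite exchange_big.
  rewrite [RHS]exchange_big; apply: eq_bigr => b _ /=.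
  by apply: eq_bigr => d _; apply: eq_bigr => e _; rewrite scalerA mulrC.
apply/matrixP => i j; rewrite !mxE.
under eq_bigr do rewrite mxE lam_u; under [RHS]eq_bigr do rewrite mxE rho_u.
(* This is f R^-1 = R^-1 g, whose entries are those of u L and P u. *)
have := kernel_transfer (x, i) (j, y) RRv RvR fg.
rewrite (sum_pair (fun a b => Rv (a, b) (j, y) *: f (x, i) (a, b))).
rewrite (sum_pair (fun a b => Rv (x, i) (a, b) *: g (a, b) (j, y))) /f /g /=.
move=> fgE; transitivity (\sum_e \sum_d \sum_b \sum_a
    (Rv (e, d) (j, y) * R (b, x) (e, a)) *: (u i b * u a d)).
  under eq_bigr do rewrite mulr_sumr.
  rewrite exchange_big; apply: eq_bigr => e _ /=.
  under eq_bigr do rewrite mulr_sumr.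
  rewrite exchange_big; apply: eq_bigr => d _ /=.
  apply: eq_bigr => b _; rewrite mulr_sumr; apply: eq_bigr => a _.
  by rewrite scalerAr.
apply: etrans; last apply: (etrans fgE).
  apply: eq_bigr => e _; apply: eq_bigr => d _.
  rewrite scaler_sumr; apply: eq_bigr => b _.
  by rewrite scaler_sumr; apply: eq_bigr => a _; rewrite scalerA.
under [RHS]eq_bigr do rewrite mulr_suml.
rewrite [RHS]exchange_big; apply: eq_bigr => a _ /=.
under [RHS]eq_bigr do rewrite mulr_suml.
rewrite [RHS]exchange_big; apply: eq_bigr => e _ /=.
rewrite scaler_sumr; apply: eq_bigr => d _.
rewrite scaler_sumr mulr_suml; apply: eq_bigr => b _.
by rewrite scalerA scalerAl.
Qed.

Hypothesis u_gen : forall Q : V -> Prop, (forall i j, Q (u i j)) ->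
  (forall a, Q a%:A) -> (forall v w, Q v -> Q w -> Q (v + w)) ->
  (forall v w, Q v -> Q w -> Q (v * w)) -> forall v, Q v.

(** As L and P are algebra maps, the w satisfying the relation form a subalgebra; by [u_gen] it
    contains everything once it contains the entries of u. *)
Lemma comm_u_lam w : u *m lam_mx c w = rho_mx c w *m u.
Proof.
elim/u_gen: w => [i j|a|v w IHv IHw|v w IHv IHw].
- exact: comm_u_lam_gen.
- rewrite lam_mxZ rho_mxZ lam_mx1 rho_mx1; apply/matrixP => i j; rewrite !mxE.
  under eq_bigr do rewrite !mxE.
  under [RHS]eq_bigr do rewrite !mxE.
  rewrite (bigD1 j) //= [RHS](bigD1 i) //= !eqxx !big1 ?addr0.
  + by rewrite -scalerAr -scalerAl mulr1 mul1r.
  + by move=> l /negPf; rewrite eq_sym => ->; rewrite mulr0n scaler0 mul0r.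
  by move=> l /negPf ->; rewrite mulr0n scaler0 mulr0.
- by rewrite lam_mxD rho_mxD mulmxDr mulmxDl IHv IHw.
by rewrite lam_mxM rho_mxM mulmxA IHv -mulmxA IHw mulmxA.
Qed.

End Commutation.
End Tmatrix.

(** * Algebra maps applied entrywise to matrices *)

Section AlgHom.
Context {k : comNzRingType}.
Implicit Types V W : algType k.

(** A predicate on plain functions, so that composites and the maps [bt_lift] can be used without
    bundling. *)
Definition alghom V W (f : V -> W) : Prop :=
  [/\ linear f, f 1 = 1 & {morph f : x y / x * y}].

Lemma alghom_comp V W (X : algType k) (g : W -> X) (f : V -> W) :
  alghom g -> alghom f -> alghom (fun v => g (f v)).
Proof.
case=> lg g1 gM [lf f1 fM]; split=> [||x y]; last by rewrite fM gM.
- exact: (linear_comp lg lf).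
- by rewrite f1 g1.
Qed.

Lemma alghom_mxM V W (f : V -> W) m n p (X : 'M_(m, n)) (Y : 'M_(n, p)) :
  alghom f -> map_mx f (X *m Y) = map_mx f X *m map_mx f Y.
Proof.
case=> lf _ fM; apply/matrixP => i j; rewrite !mxE (linear_fun_sum _ _ _ lf).
by apply: eq_bigr => a _; rewrite fM !mxE.
Qed.

Lemma alghom_mx1 V W (f : V -> W) n : alghom f -> map_mx f 1%:M = 1%:M :> 'M_n.
Proof.
case=> lf f1 _; apply/matrixP => i j; rewrite !mxE.
by case: (i == j); rewrite /= ?f1 ?(linear_fun0 lf).
Qed.

End AlgHom.

(** * Inclusions into the braided tensor product and its universal property *)

Section BtIn.
Context {k : comNzRingType} {H : algType k} {h : bialg H} {r : dqt h}.
Context {V W : algType k} {c : comodalg h V} {d : comodalg h W}.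
Context {nz : 1 *t 1 != 0 :> {tensor V & W}}.
Local Notation T := (bt r c d nz).

Definition bt_in1 (v : V) : T := v *t 1.
Definition bt_in2 (w : W) : T := 1 *t w.

Let linear_in1 : linear bt_in1.
Proof. by rewrite /bt_in1; apply: linear_tensl; lin. Qed.
Let linear_in2 : linear bt_in2.
Proof. by rewrite /bt_in2; apply: linear_tensr; lin. Qed.

HB.instance Definition _ := GRing.isLinear.Build k V T *:%R bt_in1 linear_in1.
HB.instance Definition _ := GRing.isLinear.Build k W T *:%R bt_in2 linear_in2.

Lemma bt_mulE (x y : T) : x * y = bmul r c d x y. Proof. by []. Qed.

Lemma bt_tensE v w : v *t w = bt_in1 v * bt_in2 w.
Proof.
rewrite bt_mulE bmul_tens coact1 tlift_tens; last by lin.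
by rewrite rho1 mulr1 mul1r.
Qed.

(** The cross relation between the two subalgebras. *)
Lemma bt_in21 w v :
  bt_in2 w * bt_in1 v = \sw_(v1, a <- c v) bt_in1 v1 * bt_in2 (rho r d a w).
Proof.
rewrite bt_mulE bmul_tens; apply: eq_tlift => v1 a.
by rewrite -bt_tensE mul1r mulr1.
Qed.

Lemma bt_in1_alghom : alghom bt_in1.
Proof.
split=> [||v u]; [exact: linearP | by [] |].
rewrite bt_mulE bmul_tens /bt_in1.
rewrite -[u in LHS](coact_counit c) mulr_tlift tens_tlift.
apply: eq_tlift => u1 a.
by rewrite rho_one mulr1 tensZr -scalerAr tensZl.
Qed.

Lemma bt_in2_alghom : alghom bt_in2.
Proof.
split=> [||w z]; [exact: linearP | by [] |].
rewrite bt_mulE bmul_tens /bt_in2 coact1 tlift_tens; last by lin.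
by rewrite rho1 mulr1.
Qed.

Lemma bt_in1_comod : comodule_map c (bt_comodalg r c d nz) bt_in1.
Proof.
move=> v; rewrite [LHS]coact_tensor_tens coact1; apply: eq_tlift => v1 a.
by rewrite tlift_tens ?mulr1 //; lin.
Qed.

Lemma bt_in2_comod : comodule_map d (bt_comodalg r c d nz) bt_in2.
Proof.
move=> w; rewrite [LHS]coact_tensor_tens coact1 tlift_tens; last by lin.
by apply: eq_tlift => w1 b; rewrite mul1r.
Qed.

Section Lift.
Context {D : algType k} (f : V -> D) (g : W -> D).
Hypotheses (fH : alghom f) (gH : alghom g).
Hypothesis gf : forall w v,
  g w * f v = \sw_(v1, a <- c v) f v1 * g (rho r d a w).

(** The universal property: algebra maps f and g that satisfy the cross relation [gf] extend to an
    algebra map on the braided tensor product. *)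
Definition bt_lift (x : T) : D := \sw_(v, w <- x) f v * g w.

Let lf : linear f. Proof. by case: fH. Qed.
Let lg : linear g. Proof. by case: gH. Qed.

Lemma linear_bt_lift : linear bt_lift.
Proof. by apply: tlift_linear; lin. Qed.

Lemma bt_lift_tens v w : bt_lift (v *t w) = f v * g w.
Proof. by apply: tlift_tens; lin. Qed.

Lemma bt_lift_alghom : alghom bt_lift.
Proof.
have [_ f1 fM] := fH; have [_ g1 gM] := gH.
split=> //; first exact: linear_bt_lift.
  by rewrite [LHS]bt_lift_tens f1 g1 mulr1.
move=> x y; move: x.
apply: tensor_ext => [||v w].
- by apply: (linear_comp linear_bt_lift); apply: linear_mull; lin.
- by apply: linear_mull; apply: linear_bt_lift.
move: y; apply: tensor_ext => [||u z].
- by apply: (linear_comp linear_bt_lift); apply: linear_mulr; lin.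
- by apply: linear_mulr; apply: linear_bt_lift.
rewrite bt_mulE bmul_tens !bt_lift_tens (linear_tlift _ _ linear_bt_lift).
rewrite mulrA -(mulrA (f v)) gf mulr_tlift mul_tlift.
by apply: eq_tlift => u1 a; rewrite bt_lift_tens fM gM !mulrA.
Qed.

Lemma bt_lift1 v : bt_lift (bt_in1 v) = f v.
Proof. by have [_ g1 _] := gH; rewrite bt_lift_tens g1 mulr1. Qed.

Lemma bt_lift2 w : bt_lift (bt_in2 w) = g w.
Proof. by have [_ f1 _] := fH; rewrite bt_lift_tens f1 mul1r. Qed.

End Lift.
End BtIn.

(** * The braided adjoint coaction *)

(** The bilinear form f (x) g takes the value 1 on the unit, which is therefore nonzero, as [bt]
    requires. *)
Lemma tens1_neq0 (k : comNzRingType) (V W : algType k)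
    (f : V -> k^o) (g : W -> k^o) :
  linear f -> linear g -> f 1 = 1 -> g 1 = 1 -> 1 *t 1 != 0 :> {tensor V & W}.
Proof.
move=> lf lg f1 g1; apply/eqP => /(congr1 (tlift (fun x y => f x * g y : k^o))).
rewrite tlift_tens; last by lin.
rewrite (linear_fun0 (L := tlift _)); last by lin.
by rewrite f1 g1 mulr1 => /eqP; rewrite oner_eq0.
Qed.

Lemma comodule_map_comp (k : comNzRingType) (H : algType k)
    (V W X : lmodType k) (rV : V -> {tensor V & H}) (rW : W -> {tensor W & H})
    (rX : X -> {tensor X & H}) (g : W -> X) (f : V -> W) :
  linear g -> comodule_map rV rW f -> comodule_map rW rX g ->
  comodule_map rV rX (fun v => g (f v)).
Proof.
move=> lg fP gP v; rewrite gP fP tlift_tlift; last by lin.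
by apply: eq_tlift => v1 a; rewrite tlift_tens //; lin.
Qed.

(** * Braided bialgebras and their double and triple braided tensor powers *)

Section Bbialg.
Context {k : comNzRingType} {A : algType k} {h : bialg A} {r : dqt h}.
Context {B : algType k} (b : bbialg r B).

Lemma bcomul_comod_sw (U : lmodType k) (F : B -> B -> A -> U) x : trilinear F ->
  \sw_(x', a <- b x) \sw_(y, z <- bcomul b x') F y z a =
  \sw_(y, z <- bcomul b x) \sw_(y', a <- b y) \sw_(z', a' <- b z)
    F y' z' (a * a').
Proof.
move=> triF; have [lF1 lF2 lF3] := triF.
have /(congr1 (lift3 F)) := bcomul_comod b x; rewrite /coact_tensor.
rewrite !(lift3_sw1 triF) => E.
transitivity (\sw_(x', a <- b x) lift3 F (bcomul b x' *t a)).
  by apply: eq_tlift => x' a; rewrite /lift3 tlift_tens //; lin.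
rewrite -E; apply: eq_tlift => y z; rewrite lift3_sw //.
by apply: eq_tlift => y' a; apply: eq_tlift => z' a'; rewrite lift3_tens.
Qed.

(** Covariance of the coproduct turns r of the coaction into r of a product, which [dqtMl]
    splits. *)
Lemma bcomul_rho a x : bcomul b (rho r b a x) =
  \sw_(a1, a2 <- comul h a) \sw_(y, z <- bcomul b x)
    rho r b a1 y *t rho r b a2 z.
Proof.
rewrite /rho linear_tlift; last by lin.
transitivity (\sw_(x', c <- b x) \sw_(y, z <- bcomul b x')
  r (c *t a) *: (y *t z)).
  apply: eq_tlift => x' c; rewrite linearZ -scaler_tlift.
  by rewrite tensorE.
rewrite (bcomul_comod_sw (F := fun y z c => r (c *t a) *: (y *t z)));
  last by lin.
rewrite [RHS]exchange_tlift; apply: eq_tlift => y z.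
transitivity (\sw_(y', c <- b y) \sw_(z', c' <- b z) \sw_(a1, a2 <- comul h a)
   (r (c *t a1) * r (c' *t a2)) *: (y' *t z')).
  apply: eq_tlift => y' c; apply: eq_tlift => z' c'.
  by rewrite dqtMl scale_tlift.
under eq_tlift do rewrite exchange_tlift.
rewrite exchange_tlift; apply: eq_tlift => a1 a2.
rewrite tens_tlift; apply: eq_tlift => y' c.
rewrite tensr_tlift; apply: eq_tlift => z' c'.
by rewrite tensZl tensZr scalerA.
Qed.

Lemma bcounit_rho a x : bcounit b (rho r b a x) = counit h a * bcounit b x.
Proof.
rewrite /rho (linear_tlift (U := k^o)); last by lin.
have lr : linear (fun y => r (y *t a) : k^o) by lin.
have := congr1 (fun y => r (y *t a)) (bcounit_comod b x).
rewrite (linear_tlift _ _ lr) (linear_funZ _ _ lr) dqt1l.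
move=> E; rewrite [RHS]mulrC; apply: etrans E; apply: eq_tlift => y c.
by rewrite linearZ (linear_funZ _ _ lr); apply: mulrC.
Qed.

Lemma bcounit_lam a x : bcounit b (lam r b a x) = counit h a * bcounit b x.
Proof.
rewrite /lam (linear_tlift (U := k^o)); last by lin.
have lr : linear (fun y => r (a *t y) : k^o) by lin.
have := congr1 (fun y => r (a *t y)) (bcounit_comod b x).
rewrite (linear_tlift _ _ lr) (linear_funZ _ _ lr) dqt1r.
move=> E; rewrite [RHS]mulrC; apply: etrans E; apply: eq_tlift => y c.
by rewrite linearZ (linear_funZ _ _ lr); apply: mulrC.
Qed.

Lemma bcounit_linear : linear (bcounit b : B -> k^o).
Proof. by move=> a x y; rewrite linearP. Qed.

Lemma bt2_neq0 : 1 *t 1 != 0 :> {tensor B & B}.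
Proof.
by apply: (tens1_neq0 bcounit_linear bcounit_linear); rewrite rmorph1.
Qed.

Definition bt2 := bt r b b bt2_neq0.
HB.instance Definition _ := GRing.Algebra.on bt2.
Definition bt2_coact : comodalg h bt2 := bt_comodalg r b b bt2_neq0.

Lemma bt3_neq0 : 1 *t 1 != 0 :> {tensor bt2 & B}.
Proof.
pose f (x : bt2) : k^o := \sw_(y, z <- x) bcounit b y * bcounit b z.
have bl : bilinear_for *:%R *:%R (fun x y => bcounit b x * bcounit b y : k^o).
  by split=> ?; [apply: linear_kmull | apply: linear_kmulr];
    apply: bcounit_linear.
have lf : linear f by apply: tlift_linear.
apply: (tens1_neq0 lf bcounit_linear); last by rewrite rmorph1.
apply: (etrans (tlift_tens bl _ _)); by rewrite !rmorph1 mulr1.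
Qed.

Definition bt3 := bt r bt2_coact b bt3_neq0.
HB.instance Definition _ := GRing.Algebra.on bt3.

(** The target type carries the braided algebra structure, for which the coproduct is an algebra
    map. *)
Definition comul_bt (x : B) : bt2 := bcomul b x.

Lemma comul_bt_alghom : alghom comul_bt.
Proof.
split; [exact: linearP | exact: bcomul1 | exact: bcomulM].
Qed.

Lemma comul_bt_comod : comodule_map b bt2_coact comul_bt.
Proof. exact: bcomul_comod. Qed.

Lemma comul_btE x : comul_bt x = \sw_(y, z <- bcomul b x) bt_in1 y * bt_in2 z.
Proof.
rewrite -[LHS]tensorE; apply: eq_tlift => y z; exact: bt_tensE.
Qed.

End Bbialg.

Arguments bcomul_comod_sw {k A h r B} b {U} F x _.

(** * The braided adjoint coaction: covariance, counit and triple products *)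

Section Adjoint.
Context {k : comNzRingType} {A : algType k} {h : bialg A} {r : dqt h}.
Context {B : algType k} (b : bhopf r B).
Local Notation S := (bantipode b).
Local Notation C := (bt2 b).
Local Notation psi := (comul_bt b : B -> C).
Local Notation phi := (bt_in2 : B -> C).
Local Notation j1 := (bt_in1 : B -> C).

(* In matrix form, u'' = u'^-1 (u u'): [adjoint] is the convolution product of
   [phi \o S], the inverse of [phi], and of the braided coproduct [psi]. *)
Definition adjoint (x : B) : C := \sw_(y, z <- bcomul b x) phi (S y) * psi z.

Local Notation beta := adjoint.

Let lpsi : linear psi. Proof. by case: (comul_bt_alghom b). Qed.
Let phiH : alghom phi. Proof. exact: bt_in2_alghom. Qed.
Let lphi : linear phi. Proof. by case: phiH. Qed.

Lemma linear_adjoint : linear beta.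
Proof. by rewrite /beta; lin. Qed.

HB.instance Definition _ := GRing.isLinear.Build k B C *:%R beta linear_adjoint.

Lemma bantipode1 : S 1 = 1.
Proof.
have := bantipodel b 1; rewrite bcomul1 tlift_tens; last by lin.
by rewrite rmorph1 scale1r mulr1.
Qed.

Lemma bcounit_bantipode x : bcounit b (S x) = bcounit b x.
Proof.
rewrite -[x in LHS](bcounitr b) linear_tlift; last by lin.
rewrite (linear_tlift (U := k^o)); last exact: bcounit_linear.
transitivity (bcounit b (bcounit b x *: 1 : B)); last first.
  by rewrite linearZ rmorph1; apply: mulr1.
rewrite -bantipodel (linear_tlift (U := k^o)); last exact: bcounit_linear.
by apply: eq_tlift => y z; rewrite linearZ linearZ rmorphM mulrC.
Qed.

Lemma adjoint1 : beta 1 = 1.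
Proof.
rewrite /beta bcomul1 tlift_tens; last by lin.
by have [_ -> _] := comul_bt_alghom b; rewrite bantipode1 mulr1.
Qed.

(** Convolution by [phi] on the left undoes the factor [phi] of the antipode in [adjoint]. *)
Lemma in2_mul_adjoint x : \sw_(y, z <- bcomul b x) phi y * beta z = psi x.
Proof.
have [_ phi1 phiM] := phiH.
transitivity (\sw_(y, z <- bcomul b x) \sw_(z1, z2 <- bcomul b z)
   phi y * (phi (S z1) * psi z2)).
  by apply: eq_tlift => y z; rewrite mulr_tlift.
rewrite (bcomulA_sw b (fun y z1 z2 => phi y * (phi (S z1) * psi z2)));
  last by lin.
rewrite -[x in RHS](bcounitl b).
rewrite (linear_tlift _ _ lpsi); apply: eq_tlift => y z.
transitivity (phi (\sw_(y1, y2 <- bcomul b y) y1 * S y2) * psi z).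
  rewrite (linear_tlift _ _ lphi) mul_tlift; apply: eq_tlift => y1 y2.
  by rewrite phiM mulrA.
rewrite bantipoder (linear_funZ _ _ lphi) (linear_funZ _ _ lpsi) phi1.
by rewrite -scalerAl mul1r.
Qed.

Lemma phiS_comod : comodule_map b (bt2_coact b) (fun x => phi (S x)).
Proof.
apply: comodule_map_comp lphi (bantipode_comod b) _.
exact: bt_in2_comod.
Qed.

(** The convolution product of two comodule maps into a comodule algebra is a comodule map, since
    the coproduct is one. *)
Lemma adjoint_comod : comodule_map b (bt2_coact b) beta.
Proof.
move=> x; rewrite {1}/beta (linear_tlift (L := bt2_coact b));
  last exact: linearP.
transitivity (\sw_(y, z <- bcomul b x) \sw_(y', a <- b y) \sw_(z', c <- b z)
   (phi (S y') * psi z') *t (a * c)).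
  apply: eq_tlift => y z; rewrite coactM phiS_comod.
  rewrite (comul_bt_comod b) tlift_tlift; last by lin.
  apply: eq_tlift => y' a; rewrite tlift_tens; last by lin.
  rewrite tlift_tlift; last by lin.
  by apply: eq_tlift => z' c; rewrite tlift_tens //; lin.
rewrite -(bcomul_comod_sw b (fun y z a => (phi (S y) * psi z) *t a));
  last by lin.
by apply: eq_tlift => x' a; rewrite tens_tlift.
Qed.

Let leps : alghom (fun y => bcounit b y *: 1 : B).
Proof.
split=> [a x y|| x y].
- by rewrite linearP scalerDl scalerA.
- by rewrite rmorph1 scale1r.
- by rewrite rmorphM -scalerAl mul1r scalerA.
Qed.

Let id_alghom : alghom (fun x : B => x). Proof. by []. Qed.

Let eps_comm (y x : B) : (bcounit b y *: 1) * x =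
  \sw_(x1, a <- b x) x1 * (bcounit b (rho r b a y) *: 1).
Proof.
rewrite -scalerAl mul1r -[x in LHS](coact_counit b) scaler_tlift.
apply: eq_tlift => x1 a; rewrite bcounit_rho -scalerAr mulr1 scalerA.
by rewrite mulrC.
Qed.

(** The map F = id (x) counit is an algebra map that sends [phi] to the counit and [psi] to the
    identity, so it sends [beta] to the identity. *)
Lemma adjoint_counit x : \sw_(y, z <- beta x) bcounit b z *: y = x.
Proof.
have [lF F1 FM] := bt_lift_alghom (nz := bt2_neq0 b) id_alghom leps eps_comm.
set F := bt_lift _ _ in lF F1 FM.
transitivity (F (beta x)).
  by apply: eq_tlift => y z; rewrite -scalerAr mulr1.
rewrite /beta (linear_tlift _ _ lF) -[RHS](bcounitl b).
apply: eq_tlift => y z; rewrite FM.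
rewrite [F (phi _)](bt_lift2 _ leps) // -scalerAl mul1r bcounit_bantipode.
congr (_ *: _); rewrite -[RHS](bcounitr b).
by apply: eq_tlift => z1 z2; rewrite -scalerAr mulr1.
Qed.

Local Notation D := (bt3 b).
Local Notation J12 := (bt_in1 : C -> D).
Local Notation J3 := (bt_in2 : B -> D).

Let J12H : alghom J12. Proof. exact: bt_in1_alghom. Qed.
Let J3H : alghom J3. Proof. exact: bt_in2_alghom. Qed.
Let j1H : alghom j1. Proof. exact: bt_in1_alghom. Qed.

(** The third copy crosses a covariant image of B in the first two copies through the coaction of B
    itself. *)
Let J3J12 (f : B -> C) : linear f -> comodule_map b (bt2_coact b) f ->
  forall y x, J3 y * J12 (f x) =
    \sw_(x1, a <- b x) J12 (f x1) * J3 (rho r b a y).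
Proof.
move=> lf fP y x; have [lJ _ _] := J12H; have [lJ3 _ _] := J3H.
rewrite bt_in21 fP tlift_tlift; last by lin.
by apply: eq_tlift => x1 a; rewrite tlift_tens //; lin.
Qed.

(** Multiplies the second and third copies of B; preceded by the coproduct it gives [in23]. *)
Let hphiH : alghom (bt_lift (fun y => J12 (phi y)) J3 : C -> D).
Proof.
apply: bt_lift_alghom J3H _; first exact: alghom_comp J12H phiH.
apply: J3J12 => //; exact: bt_in2_comod.
Qed.

(* The product u' u'' of the second and third copies of B. *)
Definition in23 (y : B) : D := \sw_(y1, y2 <- bcomul b y) J12 (phi y1) * J3 y2.

Lemma in23_alghom : alghom in23.
Proof. exact: (alghom_comp hphiH (comul_bt_alghom b)). Qed.

(** Both factors of [in23] cross the first copy in turn, and [bcomul_rho] reassembles the two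
    actions into one on y. *)
Lemma in23_in1 y x : in23 y * J12 (j1 x) =
  \sw_(x1, a <- b x) J12 (j1 x1) * in23 (rho r b a y).
Proof.
have [lJ _ JM] := J12H; have [lJ3 _ _] := J3H; have [lj _ _] := j1H.
rewrite mul_tlift.
transitivity (\sw_(y1, y2 <- bcomul b y) \sw_(x1, a <- b x) \sw_(x2, a' <- b x1)
   J12 (j1 x2 * phi (rho r b a' y1)) * J3 (rho r b a y2)).
  apply: eq_tlift => y1 y2.
  rewrite -mulrA (J3J12 lj (@bt_in1_comod _ _ _ _ _ _ _ _ _)).
  rewrite mulr_tlift; apply: eq_tlift => x1 a; rewrite mulrA -JM bt_in21.
  by rewrite (linear_tlift _ _ lJ) mul_tlift.
rewrite exchange_tlift; under eq_tlift do rewrite exchange_tlift.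
rewrite (coactA_sw b (fun x2 a' a => \sw_(y1, y2 <- bcomul b y)
   J12 (j1 x2 * phi (rho r b a' y1)) * J3 (rho r b a y2))); last by lin.
apply: eq_tlift => x1 a; rewrite /in23 bcomul_rho tlift_tlift; last by lin.
rewrite mulr_tlift; apply: eq_tlift => a1 a2.
rewrite tlift_tlift; last by lin.
rewrite mulr_tlift; apply: eq_tlift => y1 y2.
by rewrite tlift_tens ?JM ?mulrA //; lin.
Qed.

(** This is id (x) [bcomul], built by the universal property so as to be multiplicative; [id_comulE]
    recovers the expression of the coaction axiom. *)
Definition id_comul : C -> D := bt_lift (fun x => J12 (j1 x)) in23.

Lemma id_comul_alghom : alghom id_comul.
Proof. exact: bt_lift_alghom (alghom_comp J12H j1H) in23_alghom in23_in1. Qed.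

(** This is [beta] (x) id, the other side of the coaction axiom. *)
Definition adjoint_id : C -> D := bt_lift (fun x => J12 (beta x)) J3.

Lemma adjoint_id_alghom : alghom beta -> alghom adjoint_id.
Proof.
move=> bH; apply: bt_lift_alghom (alghom_comp J12H bH) J3H _.
exact: J3J12 linear_adjoint adjoint_comod.
Qed.

Lemma id_comulE x : id_comul x =
  \sw_(y, z <- x) \sw_(z1, z2 <- bcomul b z) y *t z1 *t z2.
Proof.
have [_ _ JM] := J12H.
apply: eq_tlift => y z; rewrite mulr_tlift; apply: eq_tlift => z1 z2.
by rewrite mulrA -JM -bt_tensE -bt_tensE.
Qed.

Lemma adjoint_idE x : adjoint_id x =
  \sw_(y, z <- x) \sw_(y1, y2 <- beta y) y1 *t y2 *t z.
Proof.
by apply: eq_tlift => y z; rewrite -bt_tensE -tens_tlift tensorE.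
Qed.

(** * The adjoint coaction on a matrix of coalgebra type *)

Section Matrix.
Context {n : nat} (u : 'M[B]_n).
Hypothesis u_comul : forall i j, bcomul b (u i j) = \sum_a u i a *t u a j.

Lemma comul_bt_mx : map_mx psi u = map_mx j1 u *m map_mx phi u.
Proof.
apply/matrixP => i j; rewrite !mxE [LHS]u_comul.
by apply: eq_bigr => a _; rewrite !mxE -bt_tensE.
Qed.

Lemma adjoint_mx : map_mx beta u = map_mx phi (map_mx S u) *m map_mx psi u.
Proof.
apply/matrixP => i j; rewrite !mxE /beta u_comul.
rewrite (linear_fun_sum (L := tlift _)); last by lin.
by apply: eq_bigr => a _; rewrite tlift_tens ?mxE //; lin.
Qed.

Lemma in23_mx : map_mx in23 u = map_mx J12 (map_mx phi u) *m map_mx J3 u.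
Proof.
apply/matrixP => i j; rewrite !mxE /in23 u_comul.
have [lJ _ _] := J12H; have [lJ3 _ _] := J3H.
rewrite (linear_fun_sum (L := tlift _)); last by lin.
by apply: eq_bigr => a _; rewrite tlift_tens ?mxE //; lin.
Qed.

Hypothesis u_counit : forall i j, bcounit b (u i j) = (i == j)%:R.

Lemma Su_u : map_mx S u *m u = 1%:M.
Proof.
apply/matrixP => i j; rewrite !mxE.
have := bantipodel b (u i j); rewrite u_comul u_counit scaler_nat => <-.
rewrite (linear_fun_sum (L := tlift _)); last by lin.
by apply: eq_bigr => a _; rewrite tlift_tens ?mxE //; lin.
Qed.

Lemma u_Su : u *m map_mx S u = 1%:M.
Proof.
apply/matrixP => i j; rewrite !mxE.
have := bantipoder b (u i j); rewrite u_comul u_counit scaler_nat => <-.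
rewrite (linear_fun_sum (L := tlift _)); last by lin.
by apply: eq_bigr => a _; rewrite tlift_tens ?mxE //; lin.
Qed.

(* Both sides are the conjugate of the first copy of u by the product of the
   other two copies. *)
Lemma adjoint_coact_mx : alghom beta ->
  map_mx adjoint_id (map_mx beta u) = map_mx id_comul (map_mx beta u).
Proof.
move=> bH; have KH := id_comul_alghom; have LH := adjoint_id_alghom bH.
have Kphi X : map_mx id_comul (map_mx phi X) = map_mx in23 X :> 'M_n.
  apply/matrixP => i j; rewrite !mxE.
  exact: (bt_lift2 (alghom_comp J12H j1H) in23_alghom).
have Kj1 X : map_mx id_comul (map_mx j1 X) = map_mx J12 (map_mx j1 X) :> 'M_n.
  apply/matrixP => i j; rewrite !mxE.
  exact: (bt_lift1 (alghom_comp J12H j1H) in23_alghom).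
have Lphi X : map_mx adjoint_id (map_mx phi X) = map_mx J3 X :> 'M_n.
  apply/matrixP => i j; rewrite !mxE.
  exact: (bt_lift2 (alghom_comp J12H bH) J3H).
have Lj1 X :
    map_mx adjoint_id (map_mx j1 X) = map_mx J12 (map_mx beta X) :> 'M_n.
  apply/matrixP => i j; rewrite !mxE.
  exact: (bt_lift1 (alghom_comp J12H bH) J3H).
rewrite adjoint_mx comul_bt_mx !(alghom_mxM _ _ KH) !(alghom_mxM _ _ LH).
rewrite Kphi Kj1 Kphi Lphi Lj1 Lphi adjoint_mx comul_bt_mx.
rewrite !(alghom_mxM _ _ J12H).
(* Both sides are inverse to the product u' u'' of [in23_mx]. *)
have in23_Su : map_mx in23 (map_mx S u) =
    map_mx J3 (map_mx S u) *m map_mx J12 (map_mx phi (map_mx S u)).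
  rewrite -[LHS]mulmx1 -(alghom_mx1 n J12H) -(alghom_mx1 n phiH) -u_Su.
  rewrite (alghom_mxM _ _ phiH) (alghom_mxM _ _ J12H).
  rewrite -[X in _ *m (X *m _)]mulmx1 -(alghom_mx1 n J3H) -u_Su.
  rewrite (alghom_mxM _ _ J3H) !mulmxA -(mulmxA (map_mx in23 _)) -in23_mx.
  rewrite -(alghom_mxM _ _ in23_alghom) Su_u.
  by rewrite (alghom_mx1 _ in23_alghom) mul1mx.
have mulmxA5 (T : nzRingType) (X1 X2 X3 X4 X5 : 'M[T]_n) :
    X1 *m (X2 *m (X3 *m X4) *m X5) = X1 *m X2 *m (X3 *m (X4 *m X5)).
  by rewrite !mulmxA.
by rewrite in23_Su in23_mx mulmxA5.
Qed.

End Matrix.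
End Adjoint.

(** * Multiplicativity on a quotient of B(R) *)

Section Mult.
Context {k : comNzRingType} {n : nat} {A : algType k} {hA : hopf A}.
Context (r : dqt hA) (t : 'I_n -> 'I_n -> A).
Hypothesis t_comul : forall i j, comul hA (t i j) = \sum_a t i a *t t a j.
Hypothesis t_counit : forall i j, counit hA (t i j) = (i == j)%:R.
Local Notation St i j := (antipode hA (t i j)).
Context {B : algType k} (b : bhopf r B) (u : 'M[B]_n).
Hypothesis u_coact : forall i j,
  b (u i j) = \sum_a \sum_c u a c *t (St i a * t c j).
Hypothesis u_comul : forall i j, bcomul b (u i j) = \sum_a u i a *t u a j.
Hypothesis u_counit : forall i j, bcounit b (u i j) = (i == j)%:R.
Local Notation P := (rho_mx r t b).
Local Notation L := (lam_mx r t b).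
Hypothesis comm_u_lam : forall w, u *m L w = P w *m u.

Local Notation S := (bantipode b).
Local Notation C := (bt2 b).
Local Notation psi := (comul_bt b : B -> C).
Local Notation phi := (bt_in2 : B -> C).
Local Notation j1 := (bt_in1 : B -> C).
Local Notation beta := (adjoint b).

Let lpsi : linear psi. Proof. by case: (comul_bt_alghom b). Qed.
Let phiH : alghom phi. Proof. exact: bt_in2_alghom. Qed.
Let j1H : alghom j1. Proof. exact: bt_in1_alghom. Qed.
Let psiH : alghom psi. Proof. exact: comul_bt_alghom. Qed.
Let lphi : linear phi. Proof. by case: phiH. Qed.
Let lj1 : linear j1. Proof. by case: j1H. Qed.
Let lbeta : linear beta. Proof. exact: linear_adjoint. Qed.

(** Crossing the entry (a, j) of u acts on w by St a m and then t c j. The sum over a cancels St a m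
    against the t i a of P, and t c j rebuilds P. *)
Lemma comm_in1_rho w :
  map_mx j1 u *m map_mx phi (P w) = map_mx phi (P w) *m map_mx j1 u.
Proof.
apply/matrixP => i j; rewrite !mxE; symmetry.
transitivity (\sum_a \sum_m \sum_c
   j1 (u m c) * phi (rho r b (t c j) (rho r b (St a m) (rho r b (t i a) w)))).
  apply: eq_bigr => a _.
  rewrite !mxE bt_in21 (tlift_coact_u u_coact); last by lin.
  by apply: eq_bigr => m _; apply: eq_bigr => c _; rewrite rho_mul.
under eq_bigr do rewrite exchange_big /=.
rewrite exchange_big; apply: eq_bigr => c _ /=; rewrite !mxE exchange_big /=.
rewrite -[RHS](sum_deltal (fun m => j1 (u m c) * phi (rho r b (t c j) w))) /=.
have lr : linear (fun x => phi (rho r b (t c j) x)) by lin.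
apply: eq_bigr => m _; rewrite -mulr_sumr -(linear_fun_sum _ _ _ lr).
by rewrite (rho_t_St r t_comul t_counit) (linear_funZ _ _ lr) scalerAr.
Qed.

(** Crossing the entry (i, a) of u' acts on w by St i m after t c a. The sum over a cancels t c a
    against the St a j of L, and St i m rebuilds L. *)
Lemma comm_in2_lam w :
  map_mx phi u *m map_mx j1 (L w) = map_mx j1 (L w) *m map_mx phi u.
Proof.
apply/matrixP => i j; rewrite !mxE.
transitivity (\sum_a \sum_m \sum_c
   j1 (lam r b (St i m) (lam r b (t c a) (lam r b (St a j) w))) * phi (u m c)).
  apply: eq_bigr => a _; rewrite !mxE bt_in21.
  (* The value of r produced by [rho] on u' is reread as a coefficient of [lam] acting on the first
     copy. *)
  transitivity (\sw_(x, y <- b (lam r b (St a j) w)) \sum_m \sum_c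
      j1 (r ((St i m * t c a) *t y) *: x) * phi (u m c)).
    apply: eq_tlift => x y; rewrite /rho (tlift_coact_u u_coact); last by lin.
    rewrite (linear_fun_sum _ _ _ lphi) mulr_sumr; apply: eq_bigr => m _.
    rewrite (linear_fun_sum _ _ _ lphi) mulr_sumr; apply: eq_bigr => c _.
    by rewrite (linear_funZ _ _ lphi) (linear_funZ _ _ lj1) -scalerAr scalerAl.
  rewrite tlift_sum; apply: eq_bigr => m _.
  rewrite tlift_sum; apply: eq_bigr => c _.
  by rewrite -lam_mul (linear_tlift _ _ lj1) mul_tlift.
rewrite exchange_big; apply: eq_bigr => m _ /=; rewrite !mxE exchange_big /=.
rewrite -[RHS](sum_deltar (fun c => j1 (lam r b (St i m) w) * phi (u m c))) /=.
have lr : linear (fun x => j1 (lam r b (St i m) x)) by lin.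
apply: eq_bigr => c _; rewrite -mulr_suml -(linear_fun_sum _ _ _ lr).
by rewrite (lam_t_St r t_comul t_counit) (linear_funZ _ _ lr) scalerAl.
Qed.

Lemma comul_bt_lam i j w : psi (lam r b (St i j) w) =
  \sw_(y, z <- bcomul b w) \sum_a
     j1 (lam r b (St i a) y) * phi (lam r b (St a j) z).
Proof.
rewrite /lam (linear_tlift _ _ lpsi).
transitivity (\sw_(x', c <- b w) \sw_(y, z <- bcomul b x') 
    r (St i j *t c) *: (j1 y * phi z)).
  apply: eq_tlift => x' c; rewrite (linear_funZ _ _ lpsi) comul_btE.
  exact: scaler_tlift.
rewrite (bcomul_comod_sw b (fun y z c => r (St i j *t c) *: (j1 y * phi z)));
  last by lin.
apply: eq_tlift => y z.
transitivity (\sw_(y', c <- b y) \sw_(z', c' <- b z) \sum_a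
   j1 (r (St i a *t c) *: y') * phi (r (St a j *t c') *: z')).
  apply: eq_tlift => y' c; apply: eq_tlift => z' c'.
  rewrite (dqt_StM r t_comul t_counit) scaler_suml; apply: eq_bigr => a _.
  rewrite (linear_funZ _ _ lphi) (linear_funZ _ _ lj1) -scalerAr -scalerAl.
  by rewrite scalerA mulrC.
under eq_tlift do rewrite tlift_sum.
rewrite tlift_sum; apply: eq_bigr => a _.
rewrite (linear_tlift _ _ lj1) mul_tlift; apply: eq_tlift => y' c.
by rewrite (linear_tlift _ _ lphi) mulr_tlift.
Qed.

Lemma comul_bt_lam_adjoint i j w : psi (lam r b (St i j) w) =
  \sw_(y, z <- bcomul b w) \sum_a
     phi (lam r b (St i a) y) * beta (lam r b (St a j) z).
Proof.
(* G multiplies out [phi] (x) [beta]; it sends the coproduct to [psi] by [in2_mul_adjoint], and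
   turns [comul_bt_lam] into the claim. *)
pose G (x : C) : C := \sw_(y, z <- x) phi y * beta z.
have lG : linear G by apply: tlift_linear; lin.
have GE y z : G (j1 y * phi z) = phi y * beta z.
  by rewrite -bt_tensE; apply: tlift_tens; lin.
rewrite -in2_mul_adjoint -[LHS]/(G (psi _)) comul_bt_lam (linear_tlift _ _ lG).
apply: eq_tlift => y z; rewrite (linear_fun_sum _ _ _ lG).
by apply: eq_bigr => a _.
Qed.

Lemma mulmx_tlift (V W : lmodType k) m p q (X : 'M[C]_(m, p))
    (F : V -> W -> 'M[C]_(p, q)) (s : {tensor V & W}) i j :
  \sum_a X i a * (\sw_(x, y <- s) F x y a j) =
  \sw_(x, y <- s) (X *m F x y) i j.
Proof.
under [RHS]eq_tlift do rewrite mxE.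
by rewrite tlift_sum; apply: eq_bigr => a _; rewrite mulr_tlift.
Qed.

(** [N w] is the value that [beta] must take on [E w] in order to be multiplicative. *)
Let E w := u *m L w.
Let N w := map_mx beta u *m map_mx beta (L w).

Let psi_mxE w : map_mx psi (E w) = map_mx psi u *m map_mx psi (L w).
Proof. exact: alghom_mxM. Qed.

(** In u u' L(w_1) L'(w_2), primes marking the second copy, u' moves past L(w_1) by [comm_in2_lam],
    which groups the product into two matrices E. *)
Lemma comul_bt_E i j w : psi (E w i j) =
  \sw_(y, z <- bcomul b w) \sum_m j1 (E y i m) * phi (E z m j).
Proof.
have /matrixP/(_ i j) := psi_mxE w; rewrite !mxE => ->.
transitivity (\sum_a map_mx psi u i a * (\sw_(y, z <- bcomul b w)
   (map_mx j1 (L y) *m map_mx phi (L z)) a j)).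
  apply: eq_bigr => a _; rewrite !mxE comul_bt_lam; congr (_ * _).
  by apply: eq_tlift => y z; rewrite mxE; apply: eq_bigr => m _; rewrite !mxE.
rewrite mulmx_tlift; apply: eq_tlift => y z.
rewrite (comul_bt_mx u_comul) -mulmxA (mulmxA (map_mx phi u)) comm_in2_lam.
rewrite !mulmxA -(alghom_mxM _ _ j1H) -mulmxA -(alghom_mxM _ _ phiH) mxE.
by apply: eq_bigr => m _; rewrite [in LHS]mxE [in X in _ * X]mxE.
Qed.

(** In u'^-1 u u' L'(w) the three factors are passed one by one: u' turns L' into P', u commutes
    with P', and u'^-1 turns P' back into L'. *)
Lemma comm_adjoint_lam w :
  map_mx beta u *m map_mx phi (L w) = map_mx phi (L w) *m map_mx beta u.
Proof.
rewrite (adjoint_mx u_comul) (comul_bt_mx u_comul).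
rewrite -!mulmxA -(alghom_mxM _ _ phiH) comm_u_lam (alghom_mxM _ _ phiH).
rewrite (mulmxA (map_mx j1 u)) comm_in1_rho !mulmxA -(alghom_mxM _ _ phiH).
(* This is u L(w) = P(w) u multiplied by the inverse of u on both sides. *)
suff <- : L w *m map_mx S u = map_mx S u *m P w.
  by rewrite (alghom_mxM _ _ phiH).
rewrite -[L w]mul1mx -(Su_u u_comul u_counit) -(mulmxA (map_mx S u)) comm_u_lam.
by rewrite mulmxA -mulmxA (u_Su u_comul u_counit) mulmx1.
Qed.

(** Here psi(u) = u' u'' and psi(L(w)) = L'(w_1) beta(L(w_2)); [comm_adjoint_lam] exchanges the two
    middle factors. *)
Lemma comul_bt_E_adjoint i j w : psi (E w i j) =
  \sw_(y, z <- bcomul b w) \sum_m phi (E y i m) * N z m j.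
Proof.
have /matrixP/(_ i j) := psi_mxE w; rewrite !mxE => ->.
transitivity (\sum_a map_mx psi u i a * (\sw_(y, z <- bcomul b w)
   (map_mx phi (L y) *m map_mx beta (L z)) a j)).
  apply: eq_bigr => a _; rewrite !mxE comul_bt_lam_adjoint; congr (_ * _).
  by apply: eq_tlift => y z; rewrite mxE; apply: eq_bigr => m _; rewrite !mxE.
rewrite mulmx_tlift; apply: eq_tlift => y z.
have -> : map_mx psi u = map_mx phi u *m map_mx beta u.
  rewrite (adjoint_mx u_comul) mulmxA -(alghom_mxM _ _ phiH).
  by rewrite (u_Su u_comul u_counit) (alghom_mx1 _ phiH) mul1mx.
rewrite -mulmxA (mulmxA (map_mx beta u)) comm_adjoint_lam -mulmxA mulmxA.
rewrite -(alghom_mxM _ _ phiH) mxE.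
by apply: eq_bigr => m _; rewrite [in LHS]mxE.
Qed.

Let lE i j : linear (fun w => E w i j).
Proof.
move=> a x y; rewrite !mxE scaler_sumr -big_split; apply: eq_bigr => m _ /=.
by rewrite !mxE scalerAr -mulrDr lam_linear.
Qed.

Let lN i j : linear (fun w => N w i j).
Proof.
move=> a x y; rewrite !mxE scaler_sumr -big_split; apply: eq_bigr => m _ /=.
by rewrite !mxE scalerAr -mulrDr lam_linear lbeta.
Qed.

Lemma bcounit_E i j w : bcounit b (E w i j) = (i == j)%:R * bcounit b w.
Proof.
rewrite mxE rmorph_sum.
transitivity (\sum_a (i == a)%:R *: (bcounit b (lam r b (St a j) w) : k^o)).
  by apply: eq_bigr => a _; rewrite rmorphM /= u_counit mxE.
by rewrite sum_deltal bcounit_lam (counit_St t_comul t_counit).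
Qed.

Lemma bantipode_E i j w :
  \sw_(y, z <- bcomul b w) \sum_m S (E y i m) * E z m j =
  ((i == j)%:R * bcounit b w) *: 1.
Proof.
pose G (x : C) : B := \sw_(y, z <- x) S y * z.
have lG : linear G by apply: tlift_linear; lin.
have GE y z : G (j1 y * phi z) = S y * z.
  by rewrite -bt_tensE; apply: tlift_tens; lin.
rewrite -bcounit_E -bantipodel -[RHS]/(G (psi (E w i j))) comul_bt_E.
rewrite (linear_tlift _ _ lG); apply: eq_tlift => y z.
by rewrite (linear_fun_sum _ _ _ lG); apply: eq_bigr => m _; rewrite GE.
Qed.

(* [adjoint] is multiplicative on products u_ij w: the coproduct of [E w] is again of
   matrix type, which makes the antipode property applicable to it. *)
Lemma adjoint_E i j w : beta (E w i j) = N w i j.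
Proof.
have [_ phi1 phiM] := phiH.
pose G (x : C) : C := \sw_(y, z <- x) phi (S y) * psi z.
have lG : linear G by apply: tlift_linear; lin.
have GE y z : G (j1 y * phi z) = phi (S y) * psi z.
  by rewrite -bt_tensE; apply: tlift_tens; lin.
have -> : beta (E w i j) = G (psi (E w i j)) by [].
rewrite comul_bt_E (linear_tlift _ _ lG).
transitivity (\sw_(x, y' <- bcomul b w) \sw_(y, z <- bcomul b y')
   \sum_m \sum_l phi (S (E x i m)) * (phi (E y m l) * N z l j)).
  apply: eq_tlift => x y'; rewrite (linear_fun_sum _ _ _ lG) tlift_sum.
  apply: eq_bigr => m _; rewrite GE comul_bt_E_adjoint mulr_tlift.
  by apply: eq_tlift => y z; rewrite mulr_sumr.
(* Coassociativity brings the two factors E together, where [bantipode_E] reduces them to the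
   counit. *)
rewrite (bcomulA_sw b (fun x y z =>
   \sum_m \sum_l phi (S (E x i m)) * (phi (E y m l) * N z l j))); last by lin.
rewrite -[w in RHS](bcounitl b) (linear_tlift _ _ (lN i j)).
apply: eq_tlift => x z; rewrite (linear_funZ _ _ (lN i j)).
transitivity (\sum_l phi (\sw_(y1, y2 <- bcomul b x)
   \sum_m S (E y1 i m) * E y2 m l) * N z l j).
  under [RHS]eq_bigr do rewrite (linear_tlift _ _ lphi) mul_tlift.
  rewrite -tlift_sum; apply: eq_tlift => y1 y2.
  rewrite exchange_big; apply: eq_bigr => l _ /=.
  rewrite (linear_fun_sum _ _ _ lphi) mulr_suml; apply: eq_bigr => m _.
  by rewrite phiM mulrA.
rewrite -(sum_deltal (fun l => N z l j)) scaler_sumr; apply: eq_bigr => l _.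
rewrite bantipode_E (linear_funZ _ _ lphi) phi1 -scalerAl mul1r.
by rewrite scalerA mulrC.
Qed.

Lemma adjoint_uM i j w : beta (u i j * w) = beta (u i j) * beta w.
Proof.
(* L is inverted by the action of t, so u w is a combination of entries of E at transformed
   arguments. *)
have uE : u i j * w = \sum_a E (lam r b (t a j) w) i a.
  transitivity (\sum_a \sum_c u i c * lam r b (St c a) (lam r b (t a j) w)).
    rewrite exchange_big -[LHS](sum_deltar (fun c => u i c * w)) /=.
    apply: eq_bigr => c _.
    by rewrite -mulr_sumr (lam_St_t r t_comul t_counit) scalerAr.
  by apply: eq_bigr => a _; rewrite mxE; apply: eq_bigr => c _; rewrite mxE.
rewrite uE (linear_fun_sum _ _ _ lbeta).
transitivity (\sum_a \sum_c
    beta (u i c) * beta (lam r b (St c a) (lam r b (t a j) w))).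
  apply: eq_bigr => a _; rewrite adjoint_E mxE.
  by apply: eq_bigr => c _; rewrite !mxE.
rewrite exchange_big -[RHS](sum_deltar (fun c => beta (u i c) * beta w)) /=.
apply: eq_bigr => c _; rewrite -mulr_sumr -(linear_fun_sum _ _ _ lbeta).
by rewrite (lam_St_t r t_comul t_counit) (linear_funZ _ _ lbeta) scalerAr.
Qed.

Hypothesis u_gen : forall Q : B -> Prop, (forall i j, Q (u i j)) ->
  (forall a, Q a%:A) -> (forall v w, Q v -> Q w -> Q (v + w)) ->
  (forall v w, Q v -> Q w -> Q (v * w)) -> forall v, Q v.

Lemma adjoint_alghom : alghom beta.
Proof.
split=> [||x y]; [exact: lbeta | exact: adjoint1 |]; move: x y.
(* Induction on the left factor with w arbitrary: the product case uses the hypothesis on v both at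
   v' w and at v'. *)
elim/u_gen => [i j|a|v v' IHv IHv'|v v' IHv IHv'] w.
- exact: adjoint_uM.
- by rewrite -scalerAl mul1r !(linear_funZ _ _ lbeta) adjoint1 -scalerAl mul1r.
- by rewrite mulrDl !(linear_funD lbeta) IHv IHv' mulrDl.
- by rewrite -mulrA IHv IHv' IHv mulrA.
Qed.

Lemma adjoint_braided_comodalg : braided_comodalg b b beta.
Proof.
have bH := adjoint_alghom; have [_ b1 bM] := bH; split.
- exact: adjoint_comod.
- move=> v; rewrite -adjoint_idE -id_comulE.
  change (adjoint_id (beta v) = id_comul (beta v)).
  have [lL L1 LM] := adjoint_id_alghom bH; have [lK K1 KM] := id_comul_alghom b.
  elim/u_gen: v => [i j|a|v w IHv IHw|v w IHv IHw].
  + have /matrixP/(_ i j) := adjoint_coact_mx u_comul u_counit bH.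
    by rewrite !mxE.
  + rewrite (linear_funZ _ _ lbeta) b1 (linear_funZ _ _ lL).
    by rewrite (linear_funZ _ _ lK) L1 K1.
  + by rewrite (linear_funD lbeta) (linear_funD lL) (linear_funD lK) IHv IHw.
  + by rewrite bM LM KM IHv IHw.
- exact: adjoint_counit.
- exact: b1.
- exact: bM.
Qed.

(** In the product u'^-1 u u' the cross relation turns the first two factors into their braiding. *)
Lemma adjoint_gen i j : beta (u i j) = \sum_a \sum_c
  bmul r b b (braiding r b b (S (u i a) *t u a c)) (1 *t u c j).
Proof.
have /matrixP/(_ i j) := adjoint_mx u_comul; rewrite !mxE => ->.
apply: eq_bigr => a _; rewrite (comul_bt_mx u_comul) !mxE mulr_sumr.
apply: eq_bigr => c _; rewrite !mxE mulrA braiding_tens bt_in21.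
congr (_ * _); apply: eq_tlift => x y.
by rewrite -bt_tensE.
Qed.

End Mult.

(** * Transfer of the structure of A(R) and B(R) to the quotients A and B *)

Theorem theorem3p9 (k : comNzRingType) (n : nat)
    (R : {tensor 'M[k]_n & 'M[k]_n}) (R_qybe : QYBE R)
    (AR : FRT_bialg R)
    (A : algType k) (hA : hopf A) (p : {lrmorphism FRT R -> A})
    (A_quotient : bialg_quotient AR hA p)
    (r : dqt hA)
    (r_gen : forall i j a b : 'I_n,
       r (p (tgen R i j) *t p (tgen R a b)) = entry R i j a b)
    (BR : BM_bbialg R (fun i j => p (tgen R i j)) r)
    (B : algType k) (hB : bhopf r B) (q : {lrmorphism BM R -> B})
    (B_quotient : bbialg_quotient BR hB q) :
  let u i j := q (ugen R i j) in
  let S := bantipode hB in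
  let Psi := braiding r hB hB in
  exists beta : {linear B -> {tensor B & B}},
    (forall i j : 'I_n, beta (u i j) =
       \sum_a \sum_b bmul r hB hB (Psi (S (u i a) *t u a b)) (1 *t u b j))
    /\ braided_comodalg hB hB beta.
Proof.
move=> u S Psi; pose t i j := p (tgen R i j).
pose U : 'M[B]_n := \matrix_(i, j) u i j.
have lq : linear q by exact: linearP.
have t_comul i j : comul hA (t i j) = \sum_a t i a *t t a j.
  rewrite (bq_comul A_quotient) frt_comul (linear_fun_sum (L := tlift _));
    last by lin.
  by apply: eq_bigr => a _; rewrite tlift_tens //; lin.
have t_counit i j : counit hA (t i j) = (i == j)%:R.
  by rewrite (bq_counit A_quotient) frt_counit.
have U_coact i j : hB (U i j) =
    \sum_a \sum_c U a c *t (antipode hA (t i a) * t c j).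
  rewrite mxE (bbq_coact B_quotient) bm_coact (linear_fun_sum (L := tlift _));
    last by lin.
  apply: eq_bigr => a _; rewrite (linear_fun_sum (L := tlift _)); last by lin.
  by apply: eq_bigr => c _; rewrite tlift_tens ?mxE //; lin.
have U_comul i j : bcomul hB (U i j) = \sum_a U i a *t U a j.
  rewrite mxE (bbq_comul B_quotient) bm_comul (linear_fun_sum (L := tlift _));
    last by lin.
  by apply: eq_bigr => a _; rewrite tlift_tens ?mxE //; lin.
have U_counit i j : bcounit hB (U i j) = (i == j)%:R.
  by rewrite mxE (bbq_counit B_quotient) bm_counit.
have U_rel i j a c :
  \sum_d \sum_e \sum_f \sum_g
    (r (t a e *t t i d) * r (t f j *t t e g)) *: (U d f * U g c) =
  \sum_d \sum_e \sum_f \sum_g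
    (r (t e g *t t i d) * r (t f j *t t g c)) *: (U a e * U d f).
  have /(congr1 q) := ugen_rel R i j a c; rewrite !rmorph_sum.
  congr (_ = _); apply: eq_bigr => d _;
  rewrite rmorph_sum; apply: eq_bigr => e _;
  rewrite rmorph_sum; apply: eq_bigr => f _; rewrite rmorph_sum;
  apply: eq_bigr => g _; rewrite !mxE /t !r_gen;
  by apply: (etrans (linear_funZ _ _ lq)); congr (_ *: _); apply: rmorphM.
(* As q is surjective, induction over expressions in the generators of B(R) descends to B. *)
have U_gen (Q : B -> Prop) : (forall i j, Q (U i j)) -> (forall a, Q a%:A) ->
    (forall v w, Q v -> Q w -> Q (v + w)) ->
    (forall v w, Q v -> Q w -> Q (v * w)) -> forall v, Q v.
  move=> QU Q1 QD QM v; have [x <-] := bbq_surj B_quotient v.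
  apply: (@presented_ind k (BM_presentation R) (fun x => Q (q x)))
    => [[i j]|a|y z Qy Qz|y z Qy Qz].
  - by have := QU i j; rewrite mxE.
  - by rewrite (linear_funZ _ _ lq) rmorph1.
  - by rewrite rmorphD; apply: QD.
  - by rewrite rmorphM; apply: QM.
have comm w := comm_u_lam t_comul t_counit U_coact U_rel U_gen w.
exists (adjoint hB); split=> [i j|].
  have := adjoint_gen U_comul i j; rewrite mxE => E; apply: (etrans E).
  by apply: eq_bigr => a _; apply: eq_bigr => c _; rewrite !mxE.
exact: (adjoint_braided_comodalg t_comul t_counit U_coact U_comul U_counit comm
  U_gen).
Qed.
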